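(* Let $A,D\in\mathbb C^{n\times n}$, let $\lambda_0$ be an eigenvalue of $A$ whose largest Jordan block has size $k$, and let $\Xi_i,\widetilde\Xi_i,W_i,s_i$ be as described in the context. Assume that $W_1,\ldots,W_k$ are all invertible. Let $\rho\in\{1,\ldots,k\}$ and let $\Theta_\rho,G_\rho^{(\rho)}$ be as in the context. Let $\Omega\in\mathbb C^{r\times r}$ be a matrix containing some eigenvalues of $\Theta_\rho$ that are different from the remaining eigenvalues of $\Theta_\rho$; that is, there is $\widetilde\Phi_\rho\in\mathbb C^{\rho s_\rho\times r}$ of rank $r$ with $\Theta_\rho\widetilde\Phi_\rho=\widetilde\Phi_\rho\Omega$, and no eigenvalue of $\Omega$ is among the remaining $\rho s_\rho-r$ eigenvalues of $\Theta_\rho$. Let $Q_1\in\mathbb C^{s_\rho\times r}$ be the top block of $\widetilde\Phi_\rho$, so that $\widetilde\Phi_\rho=\begin{bmatrix}Q_1^T&(Q_1\Omega)^T&\cdots&(Q_1\Omega^{\rho-1})^T\end{bmatrix}^T$. Then for all sufficiently small $t>0$ there are matrices $H=H(t)\in\mathbb C^{n\times r}$ and $C=C(t)\in\mathbb C^{r\times r}$ with $$(A+tD)H=HC,$$ where $$C=\lambda_0I+t^{1/\rho}\Omega+O(t^{2/\rho}),\qquad H=\widetilde\Xi_\rho\begin{bmatrix} I_{s_\rho} \\ G_\rho^{(\rho)} \end{bmatrix}Q_1+\sum_{i=1}^k\Xi_iH_i+O(t),$$ and $$H_\rho=\begin{bmatrix}0&(Q_1(t^{1/\rho}\Omega))^T&\cdots&(Q_1(t^{1/\rho}\Omega)^{\rho-1})^T\end{bmatrix}^T+O\left(\begin{bmatrix}t^{1/\rho}&t^{2/\rho}&\cdots&t\end{bmatrix}^T\right),$$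 $$H_i=O\left(\begin{bmatrix}t^{1-i/\rho}&t^{1-(i-1)/\rho}&\cdots&t^{1-1/\rho}\end{bmatrix}^T\right),\quad1\le i\le\rho-1,$$ $$H_i=O\left(\begin{bmatrix}t^{1/\rho}&t^{1/\rho}&t^{2/\rho}&\cdots&t^{1-1/\rho}&t&\cdots&t\end{bmatrix}^T\right),\quad\rho+1\le i\le k$$ (here $H_i$ is $is_i\times r$, partitioned into $i$ block rows of height $s_i$; for $i>\rho$ the first block row is $O(t^{1/\rho})$ and the $\ell$-th, $2\le\ell\le i$, is $O(t^{\min(\ell-1,\rho)/\rho})$).
   Context: Conventions. $I_m$, $0_m$ are identity and zero matrices; $B^*$ is the conjugate transpose, $B^{-*}=(B^{-1})^*$; $\Lambda(B)$ is the spectrum. Blocks with zero rows or columns are void. $O(t^c)$, as $t\to0^+$, denotes a matrix whose norm is at most a constant times $t^c$; $O([t^{c_1}\ \cdots\ t^{c_m}]^T)$ denotes a matrix partitioned into $m$ block rows, the $\ell$-th of which is $O(t^{c_\ell})$. Jordan structure. Let $[\Xi\ \ \Xi_c]\in\mathbb C^{n\times n}$ be invertible, $[\Sigma\ \ \Sigma_c]=[\Xi\ \ \Xi_c]^{-*}$, with $A[\Xi\ \ \Xi_c]=[\Xi\ \ \Xi_c]\,\mathrm{diag}(A_{11},A_{22})$, $\lambda_0\notin\Lambda(A_{22})$, $A_{11}=\lambda_0I+N$, $N=\mathrm{diag}(N_1,\ldots,N_k)$, where $N_j$ is the $j\times j$ block matrix with blocks of size $s_j\times s_j$ having $I_{s_j}$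 on the first block superdiagonal and zeros elsewhere ($N_1=0_{s_1}$). Here $s_1,\ldots,s_{k-1}\ge0$ and $s_k>0$ are integers, so $A$ has exactly $s_j$ Jordan blocks of size $j$ for $\lambda_0$. Partition conformably $\Xi=[\Xi_1\ \cdots\ \Xi_k]$, $\Xi_j=[\Xi_{j1}\ \cdots\ \Xi_{jj}]$, $\Sigma=[\Sigma_1\ \cdots\ \Sigma_k]$, $\Sigma_j=[\Sigma_{j1}\ \cdots\ \Sigma_{jj}]$, where $\Xi_{j\ell},\Sigma_{j\ell}$ have $s_j$ columns. Put $\widetilde\Xi_i=[\Xi_{i1}\ \Xi_{i+1,1}\ \cdots\ \Xi_{k1}]$, $\widetilde\Sigma_i=[\Sigma_{ii}\ \Sigma_{i+1,i+1}\ \cdots\ \Sigma_{kk}]$ and $W_i=\widetilde\Sigma_i^*D\widetilde\Xi_i$, $i=1,\ldots,k$. Matrices depending on $\rho$. $G_\rho^{(\rho)}=-W_{\rho+1}^{-1}\widetilde\Sigma_{\rho+1}^*D\,\Xi_{\rho1}$ (void if $\rho=k$), and $S_\rho=\Sigma_{\rho\rho}^*D\,\Xi_{\rho1}+(\Sigma_{\rho\rho}^*D\,\widetilde\Xi_{\rho+1})G_\rho^{(\rho)}$ (with $S_k=W_k$ if $\rho=k$). $\Theta_\rho$ is the $\rho\times\rho$ block matrix with $s_\rho\times s_\rho$ blocks having $I_{s_\rho}$ on the first block superdiagonal, $S_\rho$ in block position $(\rho,1)$ and zeros elsewhere ($\Theta_1=S_1$). *)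

(* Defs.v *)
From mathcomp Require Import all_boot all_order all_algebra.
From mathcomp Require Import complex.
From mathcomp Require Import all_classical all_reals all_analysis.

Set Implicit Arguments.
Unset Strict Implicit.
Unset Printing Implicit Defensive.

Import Order.TTheory GRing.Theory Num.Theory.
Import numFieldNormedType.Exports.

Local Open Scope classical_set_scope.
Local Open Scope complex_scope.
Local Open Scope ring_scope.

(* Indexing. A block family X : forall j, nat -> 'M_(n, s j) is read with      *)
(* 1-based indices, X j l standing for X_{jl}, 1 <= l <= j <= k; its values    *)
(* and those of s elsewhere are never used. The library's block constructors   *)
(* \mxrow, \mxcol, \mxblock count from 0, hence the shifts below.              *)

Definition ctr (R : realType) m n (B : 'M[R[i]]_(m, n)) : 'M[R[i]]_(n, m) :=
  (B ^t* )%sesqui.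

Definition jordan_dim (k : nat) (s : nat -> nat) : nat :=
  (\sum_(j < k) \sum_(l < j.+1) s j.+1)%N.

Definition jordan_cols_at (R : realType) n (s : nat -> nat)
    (X : forall j : nat, nat -> 'M[R[i]]_(n, s j)) (j : nat) :
    'M[R[i]]_(n, \sum_(l < j) s j) :=
  \mxrow_(l < j) X j l.+1.

Definition jordan_cols (R : realType) n (k : nat) (s : nat -> nat)
    (X : forall j : nat, nat -> 'M[R[i]]_(n, s j)) :
    'M[R[i]]_(n, jordan_dim k s) :=
  \mxrow_(j < k) jordan_cols_at X j.+1.

Definition full_cols (R : realType) n (k c : nat) (s : nat -> nat)
    (hn : (jordan_dim k s + c)%N = n)
    (X : forall j : nat, nat -> 'M[R[i]]_(n, s j)) (Xc : 'M[R[i]]_(n, c)) :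
    'M[R[i]]_n :=
  castmx (erefl n, hn) (row_mx (jordan_cols k X) Xc).

Definition nilp_block (R : realType) (s : nat -> nat) (j : nat) :
    'M[R[i]]_(\sum_(a < j) s j) :=
  \mxblock_(a < j, b < j) (if b == a.+1 :> nat then 1%:M else 0 : 'M[R[i]]_(s j)).

Definition jordan_part (R : realType) (k : nat) (s : nat -> nat)
    (lambda0 : R[i]) : 'M[R[i]]_(jordan_dim k s) :=
  lambda0%:M + \mxdiag_(j < k) nilp_block R s j.+1.

Definition jordan_structure (R : realType) (n k c : nat) (s : nat -> nat)
    (hn : (jordan_dim k s + c)%N = n) (A : 'M[R[i]]_n) (lambda0 : R[i])
    (Xi Sigma : forall j : nat, nat -> 'M[R[i]]_(n, s j))
    (Xic Sigmac : 'M[R[i]]_(n, c)) (A22 : 'M[R[i]]_c) : Prop :=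
  [/\ (0 < s k)%N,
      full_cols hn Xi Xic \in unitmx,
      full_cols hn Sigma Sigmac = ctr (invmx (full_cols hn Xi Xic)),
      A *m full_cols hn Xi Xic
        = full_cols hn Xi Xic
          *m castmx (hn, hn) (block_mx (jordan_part k s lambda0) 0 0 A22)
    & ~~ eigenvalue A22 lambda0].

(* [X_{i1} X_{i+1,1} ... X_{k1}]; void for i = k + 1 *)
Definition first_cols (R : realType) n (k : nat) (s : nat -> nat)
    (X : forall j : nat, nat -> 'M[R[i]]_(n, s j)) (i : nat) :
    'M[R[i]]_(n, \sum_(j < k.+1 - i) s (i + j)%N) :=
  \mxrow_(j < k.+1 - i) X (i + j)%N 1%N.

(* [X_{ii} X_{i+1,i+1} ... X_{kk}]; void for i = k + 1 *)
Definition last_cols (R : realType) n (k : nat) (s : nat -> nat)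
    (X : forall j : nat, nat -> 'M[R[i]]_(n, s j)) (i : nat) :
    'M[R[i]]_(n, \sum_(j < k.+1 - i) s (i + j)%N) :=
  \mxrow_(j < k.+1 - i) X (i + j)%N (i + j)%N.

Definition Wmx (R : realType) n (k : nat) (s : nat -> nat) (D : 'M[R[i]]_n)
    (Xi Sigma : forall j : nat, nat -> 'M[R[i]]_(n, s j)) (i : nat) :
    'M[R[i]]_(\sum_(j < k.+1 - i) s (i + j)%N) :=
  ctr (last_cols k Sigma i) *m D *m first_cols k Xi i.

Definition Gmx (R : realType) n (k : nat) (s : nat -> nat) (D : 'M[R[i]]_n)
    (Xi Sigma : forall j : nat, nat -> 'M[R[i]]_(n, s j)) (rho : nat) :
    'M[R[i]]_(\sum_(j < k.+1 - rho.+1) s (rho.+1 + j)%N, s rho) :=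
  - (invmx (Wmx k D Xi Sigma rho.+1)
     *m (ctr (last_cols k Sigma rho.+1) *m D *m Xi rho 1%N)).

(* For rho = k the second summand is a product of void matrices, hence 0, and  *)
(* S_k is Sigma_{kk}^* D Xi_{k1} = W_k.                                        *)
Definition Smx (R : realType) n (k : nat) (s : nat -> nat) (D : 'M[R[i]]_n)
    (Xi Sigma : forall j : nat, nat -> 'M[R[i]]_(n, s j)) (rho : nat) :
    'M[R[i]]_(s rho) :=
  ctr (Sigma rho rho) *m D *m Xi rho 1%N
  + (ctr (Sigma rho rho) *m D *m first_cols k Xi rho.+1)
    *m Gmx k D Xi Sigma rho.

Definition Thetamx (R : realType) n (k : nat) (s : nat -> nat) (D : 'M[R[i]]_n)
    (Xi Sigma : forall j : nat, nat -> 'M[R[i]]_(n, s j)) (rho : nat) :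
    'M[R[i]]_(\sum_(a < rho) s rho) :=
  \mxblock_(a < rho, b < rho)
    (if b == a.+1 :> nat then 1%:M
     else if (a.+1 == rho) && (b == 0%N :> nat) then Smx k D Xi Sigma rho
     else 0 : 'M[R[i]]_(s rho)).

(* [Xi~_rho [I; G]], with Xi~_rho split as [Xi_{rho 1} Xi~_{rho+1}] *)
Definition leading_cols (R : realType) n (k : nat) (s : nat -> nat)
    (D : 'M[R[i]]_n) (Xi Sigma : forall j : nat, nat -> 'M[R[i]]_(n, s j))
    (rho : nat) : 'M[R[i]]_(n, s rho) :=
  row_mx (Xi rho 1%N) (first_cols k Xi rho.+1)
  *m col_mx 1%:M (Gmx k D Xi Sigma rho).

(* rest lists, with multiplicity, the eigenvalues of Theta left over when those *)
(* of Omega are removed.                                                        *)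
Definition remaining_eigenvalues (R : realType) m r (Theta : 'M[R[i]]_m)
    (Omega : 'M[R[i]]_r) (rest : seq R[i]) : Prop :=
  char_poly Theta = char_poly Omega * \prod_(z <- rest) ('X - z%:P).

(* F(t) = O(t^e) as t -> 0+; the norm is the library's max norm on matrices.   *)
Definition isO_pow (R : realType) m p (F : R -> 'M[R[i]]_(m, p)) (e : R) :
    Prop :=
  F =O_ (0^'+) (fun t : R => (t `^ e)%:C : R[i]^o).

(* F(t) = O([t^(e 1) ... t^(e i)]^T), for F split into i block rows *)
Definition isO_pow_blocks (R : realType) (i d p : nat)
    (F : R -> 'M[R[i]]_(\sum_(l < i) d, p)) (e : nat -> R) : Prop :=
  forall l : 'I_i, isO_pow (fun t => submxcol (F t) l) (e l.+1).

(* Main.v *)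
(* With e = t^(1/rho), write H = L(e) V, where the diagonal scaling L(e) multiplies
   the Jordan coordinate (j, l) of V by the power of e that the theorem predicts
   for it, and C = lambda0 I + e G. After the rows are divided by suitable powers
   of e, (A + t D) H = H C becomes M(e) V = K(e) V G with M and K polynomial in e.
   At e = 0 the perturbation D only acts on the coordinates (j, 1), j >= rho. Since
   W_(rho+1) is invertible, those with j > rho are G_rho^(rho) times the one with
   j = rho, and the coordinates of the chains of length rho then satisfy the
   eigenvalue equation of Theta_rho. Thus (V, G) = (V0, Omega) solves the limit problem, and
   because Omega shares no eigenvalue with the rest of Theta_rho, nor with 0, the
   linearisation there is injective once V is normalised. A contraction argument
   gives a solution with V = V0 + O(e) and G = Omega + O(e). *)
From HB Require Import structures.
Require Import Defs.
From mathcomp Require Import all_boot all_order all_algebra.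
From mathcomp Require Import complex zify lra ring.
From mathcomp Require Import all_classical all_reals all_analysis.

Set Implicit Arguments.
Unset Strict Implicit.
Unset Printing Implicit Defensive.

Import Order.TTheory GRing.Theory Num.Theory.
Import numFieldNormedType.Exports.

Local Open Scope classical_set_scope.
Local Open Scope complex_scope.
Local Open Scope ring_scope.

(** * A real-valued matrix norm *)

Lemma normc_ge0 (R : realType) (x : R[i]) : 0 <= Normc.normc x.
Proof. by case: x => a b; exact: sqrtr_ge0. Qed.

Lemma normc_norm (R : realType) (x : R[i]) : `|x| = (Normc.normc x)%:C.
Proof. by rewrite normc_def; case: x. Qed.

Lemma normc_real (R : realType) (x : R) : 0 <= x -> Normc.normc x%:C = x.
Proof. by move=> x0; rewrite /= expr0n addr0 sqrtr_sqr ger0_norm. Qed.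

(* The library's matrix norm takes its values in R[i]; this one is real. *)
Definition nrm (R : realType) m p (M : 'M[R[i]]_(m, p)) : R :=
  \sum_i \sum_j Normc.normc (M i j).

Section Norm.
Variable R : realType.

Lemma nrm_ge0 m p (M : 'M[R[i]]_(m, p)) : 0 <= nrm M.
Proof. by apply: sumr_ge0 => i _; apply: sumr_ge0 => j _; exact: normc_ge0. Qed.

Lemma nrm0 m p : nrm (0 : 'M[R[i]]_(m, p)) = 0.
Proof.
by rewrite /nrm big1// => i _; rewrite big1// => j _; rewrite mxE Normc.normc0.
Qed.

Lemma nrmD m p (M N : 'M[R[i]]_(m, p)) : nrm (M + N) <= nrm M + nrm N.
Proof.
rewrite /nrm -big_split; apply: ler_sum => i _.
by rewrite -big_split; apply: ler_sum => j _; rewrite mxE le_normcD.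
Qed.

Lemma nrmN m p (M : 'M[R[i]]_(m, p)) : nrm (- M) = nrm M.
Proof. by apply: eq_bigr => i _; apply: eq_bigr => j _; rewrite mxE normcN. Qed.

Lemma nrmZ m p (a : R) (M : 'M[R[i]]_(m, p)) :
  0 <= a -> nrm (a%:C *: M) = a * nrm M.
Proof.
move=> a0; rewrite /nrm mulr_sumr; apply: eq_bigr => i _.
rewrite mulr_sumr; apply: eq_bigr => j _.
by rewrite mxE Normc.normcM normc_real.
Qed.

Lemma normc_le_nrm m p (M : 'M[R[i]]_(m, p)) i j : Normc.normc (M i j) <= nrm M.
Proof.
rewrite /nrm (bigD1 i)//= (bigD1 j)//= -addrA lerDl addr_ge0//.
  by apply: sumr_ge0 => ? _; exact: normc_ge0.
by apply: sumr_ge0 => ? _; apply: sumr_ge0 => ? _; exact: normc_ge0.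
Qed.

Lemma nrm_eq0 m p (M : 'M[R[i]]_(m, p)) : nrm M <= 0 -> M = 0.
Proof.
move=> M0; apply/matrixP => i j; rewrite mxE; apply: Normc.eq0_normc.
by apply/eqP; rewrite eq_le normc_ge0 (le_trans (normc_le_nrm _ i j)).
Qed.

Lemma normc_sum (I : finType) (F : I -> R[i]) :
  Normc.normc (\sum_i F i) <= \sum_i Normc.normc (F i).
Proof.
elim/big_ind2: _ => [|x1 x2 y1 y2 h1 h2|//]; first by rewrite Normc.normc0.
exact: le_trans (le_normcD _ _) (lerD h1 h2).
Qed.

Lemma nrmM m p q (M : 'M[R[i]]_(m, p)) (N : 'M[R[i]]_(p, q)) :
  nrm (M *m N) <= nrm M * nrm N.
Proof.
rewrite {1 2}/nrm mulr_suml; apply: ler_sum => i _; rewrite mulr_suml.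
apply: (@le_trans _ _ (\sum_j Normc.normc (M i j) * \sum_k Normc.normc (N j k))).
  under [leRHS]eq_bigr do rewrite mulr_sumr.
  rewrite exchange_big/=; apply: ler_sum => k _; rewrite mxE.
  apply: le_trans (normc_sum _) _; apply: ler_sum => j _.
  by rewrite Normc.normcM.
apply: ler_sum => j _; apply: ler_wpM2l; first exact: normc_ge0.
rewrite /nrm [leRHS](bigD1 j)//= lerDl.
by apply: sumr_ge0 => ? _; apply: sumr_ge0 => ? _; exact: normc_ge0.
Qed.

Lemma mxnorm_le_nrm m p (M : 'M[R[i]]_(m, p)) : `|M| <= (nrm M)%:C.
Proof.
have [/eqP|] := eqVneq (mx_norm M) 0.
  by rewrite -[mx_norm M]/(`|M|) => /eqP ->; rewrite lecR nrm_ge0.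
move=> /mx_norm_neq0[[i j] e]; rewrite -[`|M|]/(mx_norm M) e/= normc_norm lecR.
exact: normc_le_nrm.
Qed.

(** Every big-O claim of the theorem is obtained through this lemma from an explicit bound on an
    interval [0 < t <= t0]. *)
Lemma isO_pow_nrm m p (F : R -> 'M[R[i]]_(m, p)) (e b t0 : R) :
  0 < t0 -> (forall t, 0 < t <= t0 -> nrm (F t) <= b * t `^ e) -> isO_pow F e.
Proof.
move=> t00 hF; rewrite /isO_pow; apply/eqO_exP.
(* The constant has to be positive, and [b] may have any sign. *)
exists (`|b| + 1)%:C; first by rewrite ltcR ltr_wpDl.
near=> t.
apply: le_trans (mxnorm_le_nrm _) _.
rewrite [`|_ : R[i]^o|]normc_norm normc_real ?powR_ge0//= -rmorphM lecR.
apply: (@le_trans _ _ (b * t `^ e)).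
  by apply: hF; apply/andP; split; near: t; [exact: nbhs_right_gt|exact: nbhs_right_le].
apply: ler_wpM2r; first exact: powR_ge0.
by rewrite (le_trans (ler_norm b))// lerDl.
Unshelve. all: by end_near. Qed.

Lemma mul_vec_linE m p (f : {linear 'M[R[i]]_(m, p) -> 'M[R[i]]_(m, p)}) M :
  f M = vec_mx (mxvec M *m lin_mx f).
Proof. by rewrite mul_vec_lin mxvecK. Qed.

Lemma nrm_mxvec m p (M : 'M[R[i]]_(m, p)) : nrm (mxvec M) = nrm M.
Proof.
rewrite /nrm big_ord1 pair_bigA/=.
rewrite (reindex (uncurry (@mxvec_index m p)))/=; last first.
  exact: curry_mxvec_bij.
by apply: eq_bigr => -[i j] _; rewrite mxvecE.
Qed.

(** Source and target have the same finite dimension, so injectivity makes the matrix of [f] on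
    [mxvec] rows invertible; [g] multiplies by the inverse, whose norm serves as [c]. *)
Lemma injective_linear_inverse m p
    (f : {linear 'M[R[i]]_(m, p) -> 'M[R[i]]_(m, p)}) :
  (forall M, f M = 0 -> M = 0) ->
  exists (g : 'M[R[i]]_(m, p) -> 'M[R[i]]_(m, p)) (c : R),
    [/\ 0 <= c, forall M, f (g M) = M, {morph g : M N / M - N} &
        forall M, nrm (g M) <= c * nrm M].
Proof.
move=> finj; have fu : lin_mx f \in unitmx.
  rewrite -row_free_unit -kermx_eq0; apply/eqP/row_matrixP => i; rewrite row0.
  rewrite -[row i _]vec_mxK -[RHS](linear0 mxvec); congr mxvec; apply: finj.
  by rewrite mul_vec_linE vec_mxK -row_mul mulmx_ker row0 linear0.
exists (fun M => vec_mx (mxvec M *m invmx (lin_mx f))), (nrm (invmx (lin_mx f))).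
split=> [|M|M N|M]; first exact: nrm_ge0.
- by rewrite mul_vec_linE vec_mxK mulmxKV ?mxvecK.
- by rewrite linearB/= mulmxBl linearB.
- by rewrite -nrm_mxvec vec_mxK -[nrm M]nrm_mxvec mulrC nrmM.
Qed.

End Norm.

(** * Perturbation of a deflating subspace *)

Section Contraction.
Variable R : realType.

(** If [x > y], some power of 2 exceeds [c / (x - y)]. This replaces passages to the limit below. *)
Lemma le_add_geometric (x y c : R) :
  (forall k, x <= y + c * 2^-1 ^+ k) -> x <= y.
Proof.
move=> h; rewrite leNgt; apply/negP => yx.
have c0 : 0 <= c / (x - y).
  have := h 0%N; rewrite expr0 mulr1 => h0.
  by rewrite divr_ge0 ?subr_ge0 1?ltW//; lra.
have := archi_boundP c0; set b := Num.bound _ => hb.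
have b2 : b%:R <= 2 ^+ b :> R by rewrite -natrX ler_nat ltnW// ltn_expl.
have := h b; rewrite exprVn -lerBlDl ler_pdivlMr ?exprn_gt0//.
move: hb; rewrite ltr_pdivrMr ?subr_gt0// => hb.
have : b%:R * (x - y) <= 2 ^+ b * (x - y) by rewrite ler_wpM2r// subr_ge0 ltW.
by rewrite [_ * 2 ^+ b]mulrC; lra.
Qed.

(** The steps after [k] add up to at most [2 * d * 2^-1 ^+ k]. Hence every lower end
    [u k - 2 * d * 2^-1 ^+ k] lies below every upper end, and the supremum of the lower ends is the
    limit. *)
Lemma geometric_limit (u : nat -> R) (d : R) :
  (forall k, `|u k.+1 - u k| <= d * 2^-1 ^+ k) ->
  exists a, forall k, `|a - u k| <= 2 * d * 2^-1 ^+ k.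
Proof.
move=> hu.
have d0 : 0 <= d by have := hu 0%N; rewrite expr0 mulr1; apply: le_trans.
have q0 k : 0 <= d * 2^-1 ^+ k by rewrite mulr_ge0// exprn_ge0// invr_ge0.
have hm k m : `|u (k + m)%N - u k| <= 2 * d * 2^-1 ^+ k - 2 * d * 2^-1 ^+ (k + m).
  elim: m => [|m IH]; first by rewrite addn0 !subrr normr0.
  have e : 2 * d * 2^-1 ^+ (k + m).+1 = d * 2^-1 ^+ (k + m).
    by rewrite exprS; field.
  rewrite addnS e; have := hu (k + m)%N; rewrite !ler_norml.
  by move: IH; rewrite !ler_norml => /andP[? ?] /andP[? ?]; apply/andP; split; lra.
have hle m k : u m - 2 * d * 2^-1 ^+ m <= u k + 2 * d * 2^-1 ^+ k.
  have := q0 m; have := q0 k.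
  have [/subnKC e|/ltnW/subnKC e] := leqP k m.
    by have := hm k (m - k)%N; rewrite e ler_norml => /andP[? ?] ? ?; lra.
  by have := hm m (k - m)%N; rewrite e ler_norml => /andP[? ?] ? ?; lra.
pose A := range (fun k => u k - 2 * d * 2^-1 ^+ k).
have A0 : A !=set0 by exists (u 0%N - 2 * d * 2^-1 ^+ 0), 0%N.
exists (sup A) => k; rewrite ler_norml; apply/andP; split.
  have : u k - 2 * d * 2^-1 ^+ k <= sup A.
    apply: ub_le_sup; last by exists k.
    by exists (u k + 2 * d * 2^-1 ^+ k) => _ [m _ <-]; exact: hle.
  by lra.
have : sup A <= u k + 2 * d * 2^-1 ^+ k.
  by apply: ge_sup => // _ [m _ <-]; exact: hle.
by lra.
Qed.

Lemma normc_le_ReIm (x : R[i]) : Normc.normc x <= `|complex.Re x| + `|complex.Im x|.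
Proof.
case: x => a b /=; rewrite -[leRHS]ger0_norm ?addr_ge0// -sqrtr_sqr ler_sqrt ?sqr_ge0//.
by rewrite sqrrD !real_normK ?num_real//; have := mulr_ge0 (normr_ge0 a) (normr_ge0 b); lra.
Qed.

Lemma ReIm_le_normc (x : R[i]) :
  (`|complex.Re x| <= Normc.normc x) && (`|complex.Im x| <= Normc.normc x).
Proof.
case: x => a b /=; rewrite -!sqrtr_sqr !ler_sqrt ?addr_ge0 ?sqr_ge0//.
by rewrite lerDl lerDr !sqr_ge0.
Qed.

(** Convergence is entrywise. The real and imaginary parts each have error [2 * d * 2^-1 ^+ k],
    hence [4 * d] per entry. *)
Lemma nrm_geometric_limit m p (U : nat -> 'M[R[i]]_(m, p)) (d : R) :
  (forall k, nrm (U k.+1 - U k) <= d * 2^-1 ^+ k) ->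
  exists L c, forall k, nrm (L - U k) <= c * 2^-1 ^+ k.
Proof.
move=> hU.
have hz i j : exists z : R[i], forall k,
    Normc.normc (z - U k i j) <= 4 * d * 2^-1 ^+ k.
  have [k|a ha] := @geometric_limit (fun k => complex.Re (U k i j)) d.
    apply: le_trans (hU k); apply: le_trans (normc_le_nrm _ i j).
    by have /andP[+ _] := ReIm_le_normc ((U k.+1 - U k) i j); rewrite !mxE raddfB.
  have [k|b hb] := @geometric_limit (fun k => complex.Im (U k i j)) d.
    apply: le_trans (hU k); apply: le_trans (normc_le_nrm _ i j).
    by have /andP[_] := ReIm_le_normc ((U k.+1 - U k) i j); rewrite !mxE raddfB.
  exists (a +i* b) => k; apply: le_trans (normc_le_ReIm _) _.
  have := ha k; have := hb k; case: (U k i j) => x y /= h1 h2.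
  by have := lerD h1 h2; lra.
have [f hf] := boolp.choice (fun ij : 'I_m * 'I_p => hz ij.1 ij.2).
exists (\matrix_(i, j) f (i, j)), (\sum_(i < m) \sum_(j < p) (4 * d)) => k.
rewrite /nrm mulr_suml; apply: ler_sum => i _; rewrite mulr_suml.
by apply: ler_sum => j _; rewrite !mxE; exact: (hf (i, j)).
Qed.

(** Banach iteration from 0 with factor one half: the step bounds halve each time, so the iterates
    and their limit stay within [2 * nrm (F 0) <= r], where the contraction bound applies. *)
Lemma contraction_fixpoint m p (F : 'M[R[i]]_(m, p) -> 'M[R[i]]_(m, p)) (r : R) :
  nrm (F 0) <= r / 2 ->
  (forall U V, nrm U <= r -> nrm V <= r -> nrm (F U - F V) <= nrm (U - V) / 2) ->
  exists2 U, F U = U & nrm U <= 2 * nrm (F 0).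
Proof.
move=> F0 hF; set f0 := nrm (F 0) in F0 *.
have f00 : 0 <= f0 by exact: nrm_ge0.
pose U k := iter k F 0.
have qk k : 0 <= f0 * 2^-1 ^+ k by rewrite mulr_ge0// exprn_ge0// invr_ge0.
have hU k : nrm (U k) <= 2 * f0 - 2 * (f0 * 2^-1 ^+ k) /\
            nrm (U k.+1 - U k) <= f0 * 2^-1 ^+ k.
  elim: k => [|k [IH1 IH2]]; first by rewrite expr0 mulr1 subrr nrm0/= subr0.
  have e : nrm (U k.+1) <= 2 * f0 - 2 * (f0 * 2^-1 ^+ k.+1).
    rewrite -[U k.+1](subrK (U k)); apply: le_trans (nrmD _ _) _.
    by apply: le_trans (lerD IH2 IH1) _; rewrite exprS; lra.
  split=> //; apply: le_trans (hF _ _ _ _) _.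
  - by have := qk k.+1; lra.
  - by have := qk k; lra.
  - by rewrite exprS; lra.
have [|L [c hL]] := @nrm_geometric_limit _ _ U f0; first by move=> k; case: (hU k).
have L0 : nrm L <= 2 * f0.
  apply: (@le_add_geometric _ _ c) => k.
  rewrite -[L](subrK (U k)); apply: le_trans (nrmD _ _) _.
  by have := hL k; have [] := hU k; have := qk k; lra.
exists L => //; apply/eqP; rewrite -subr_eq0; apply/eqP/nrm_eq0.
(* [F L] and [L] are both compared with the iterate [U k.+1], which is [F (U k)]. *)
apply: (@le_add_geometric _ _ c) => k.
rewrite -(subrKA (U k.+1)) add0r; apply: le_trans (nrmD _ _) _.
have h1 : nrm (F L - U k.+1) <= nrm (L - U k) / 2.
  by apply: hF; [lra|have [] := hU k; have := qk k; lra].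
have := hL k; have := hL k.+1; rewrite -nrmN opprB exprS.
by move: h1; lra.
Qed.

Lemma mulmx_subE m p q (A A' : 'M[R[i]]_(m, p)) (B B' : 'M[R[i]]_(p, q)) :
  A *m B - A' *m B' = (A - A') *m B + A' *m (B - B').
Proof. by rewrite mulmxBl mulmxBr addrA subrK. Qed.

Lemma nrm_col_mx m1 m2 p (A : 'M[R[i]]_(m1, p)) (B : 'M[R[i]]_(m2, p)) :
  nrm (col_mx A B) = nrm A + nrm B.
Proof.
rewrite /nrm big_split_ord/=; congr (_ + _); apply: eq_bigr => i _;
  by apply: eq_bigr => j _; rewrite (col_mxEu, col_mxEd).
Qed.

(** For a solution [V0 + Z], [Om + Dl], the terms linear in [(Z, Dl)] at the limit, joined with
    [P *m Z], form an injective endomorphism by the last hypothesis. Inverting it gives a fixed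
    point problem whose other terms carry a factor of order [e] or are quadratic, hence a
    contraction on a small ball. *)
Lemma deflating_subspace_perturbation n r (M0 K0 : 'M[R[i]]_n)
    (M K : R -> 'M[R[i]]_n) (a : R) (V0 : 'M[R[i]]_(n, r)) (Om : 'M[R[i]]_r)
    (P : 'M[R[i]]_(r, n)) :
  (forall e, 0 <= e <= 1 -> nrm (M e - M0) <= a * e /\ nrm (K e - K0) <= a * e) ->
  M0 *m V0 = K0 *m V0 *m Om ->
  (forall Z Dl, M0 *m Z = K0 *m Z *m Om + K0 *m V0 *m Dl -> P *m Z = 0 ->
     Z = 0 /\ Dl = 0) ->
  exists b e0, [/\ 0 <= b, 0 < e0 & forall e, 0 <= e <= e0 -> exists Z Dl,
    [/\ M e *m (V0 + Z) = K e *m (V0 + Z) *m (Om + Dl),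
        nrm Z <= b * e & nrm Dl <= b * e]].
Proof.
move=> hMK hV0 hinj.
have a0 : 0 <= a.
  have [|h _] := hMK 1; first by rewrite lexx ler01.
  by rewrite mulr1 in h; apply: le_trans h; exact: nrm_ge0.
(* [U] stacks [Z] on [Dl]. The [r] rows of [P *m Z] balance the extra unknown [Dl], so that [f] is
   an endomorphism. *)
pose f (U : 'M[R[i]]_(n + r, r)) :=
  col_mx (M0 *m usubmx U - K0 *m usubmx U *m Om - K0 *m V0 *m dsubmx U)
         (P *m usubmx U).
have f_lin : linear f.
  move=> x U V; rewrite /f !linearP/= !mulmxDl -!scalemxAl.
  rewrite scale_col_mx add_col_mx; congr col_mx.
  rewrite !scalerDr !scalerN !opprD !addrA.
  by rewrite [LHS](ACl (1 * 3 * 5 * 2 * 4 * 6)).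
pose fL := HB.pack_for {linear 'M[R[i]]_(n + r, r) -> 'M[R[i]]_(n + r, r)} f
  (GRing.isLinear.Build _ _ _ _ f f_lin).
have [|g [c [c0 fg gB gc]]] := @injective_linear_inverse R _ _ fL.
  move=> U; rewrite /= /f -[0 in RHS]col_mx0 => /eq_col_mx[h1 h2].
  have [|//|h3 h4] := hinj (usubmx U) (dsubmx U).
    by apply/eqP; rewrite -subr_eq0 opprD addrA h1.
  by rewrite -[U]vsubmxK h3 h4 col_mx0.
set v := nrm V0; set o := nrm Om; set k0 := nrm K0.
have v0 : 0 <= v by exact: nrm_ge0.
have o0 : 0 <= o by exact: nrm_ge0.
have k00 : 0 <= k0 by exact: nrm_ge0.
(* On the ball of radius [d] the quadratic term contributes at most 1/8 to the contraction
   factor. *)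
pose d := (1 + 8 * (c * k0))^-1.
have ck0 : 0 <= c * k0 by exact: mulr_ge0.
have d0 : 0 < d by rewrite invr_gt0; lra.
have d1 : d <= 1 by rewrite invf_le1; lra.
have dck : 8 * (c * k0 * d) <= 1.
  by rewrite mulrA ler_pdivrMr; lra.
(* For [e <= d / s] the three summands of [s] give, in turn, [e <= 1], a contribution of at most 1/4
   to the contraction factor, and [nrm (F 0) <= d / 4]. *)
pose s := 4 * (1 + c * a * (3 + o + v) + c * a * (v * (1 + o))).
have s1 : 0 <= c * a * (3 + o + v) by rewrite !mulr_ge0// !addr_ge0.
have s2 : 0 <= c * a * (v * (1 + o)) by rewrite !mulr_ge0// addr_ge0.
exists (2 * (c * a * (v * (1 + o)))), (d / s).
have s0 : 0 < s by rewrite /s; lra.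
split=> [||e /andP[e0 eds]]; [by rewrite mulr_ge0|by rewrite divr_gt0|].
have {}eds : e * s <= d by rewrite -ler_pdivlMr.
have e1 : e <= 1.
  by have : e * 4 <= e * s; [apply: ler_wpM2l => //; rewrite /s; lra|lra].
have es1 : c * a * (3 + o + v) * e <= d / 4.
  have : 4 * (c * a * (3 + o + v)) * e <= e * s; last by lra.
  by rewrite [leRHS]mulrC; apply: ler_wpM2r => //; rewrite /s; lra.
have es2 : c * a * (v * (1 + o)) * e <= d / 4.
  have : 4 * (c * a * (v * (1 + o))) * e <= e * s; last by lra.
  by rewrite [leRHS]mulrC; apply: ler_wpM2r => //; rewrite /s; lra.
have [hM hK] : nrm (M e - M0) <= a * e /\ nrm (K e - K0) <= a * e.
  by apply: hMK; rewrite e0.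
(* [E U] collects what [f] leaves out: the deviations of [M e] and [K e] from their limits, and the
   product [Z *m Dl]. *)
pose E (U : 'M[R[i]]_(n + r, r)) := let Z := usubmx U in let Dl := dsubmx U in
  (K e - K0) *m ((V0 + Z) *m (Om + Dl)) - (M e - M0) *m (V0 + Z) + K0 *m (Z *m Dl).
have mulle m p q (X : 'M[R[i]]_(m, p)) (Y : 'M[R[i]]_(p, q)) x y :
    nrm X <= x -> nrm Y <= y -> nrm (X *m Y) <= x * y.
  by move=> hx hy; apply: le_trans (nrmM _ _) _; apply: ler_pM => //; exact: nrm_ge0.
have addle m p (X Y : 'M[R[i]]_(m, p)) x y :
    nrm X <= x -> nrm Y <= y -> nrm (X + Y) <= x + y.
  by move=> hx hy; apply: le_trans (nrmD _ _) _; exact: lerD.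
have addlK m p (X Y Y' : 'M[R[i]]_(m, p)) : X + Y - (X + Y') = Y - Y'.
  by rewrite opprD addrACA subrr add0r.
have nrmU (U : 'M[R[i]]_(n + r, r)) : nrm U = nrm (usubmx U) + nrm (dsubmx U).
  by rewrite -{1}[U]vsubmxK; exact: nrm_col_mx.
have hE0 : nrm (E 0) <= a * e * (v * (1 + o)).
  rewrite /E /= !linear0 !addr0.
  have -> : a * e * (v * (1 + o)) = a * e * (v * o) + a * e * v by ring.
  apply: (addle); first by apply: (mulle) => //; exact: (mulle).
  by rewrite nrmN; exact: (mulle).
have hE U U' : nrm U <= d -> nrm U' <= d ->
    nrm (E U - E U') <= nrm (U - U') * (a * e * (3 + o + v) + k0 * d).
  rewrite (nrmU (U - U')) (nrmU U) (nrmU U') => hU hU'.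
  pose Z := usubmx U; pose Z' := usubmx U'.
  pose D := dsubmx U; pose D' := dsubmx U'.
  have zs : usubmx (U - U') = Z - Z' by rewrite linearB.
  have ds : dsubmx (U - U') = D - D' by rewrite linearB.
  rewrite zs ds.
  have -> : E U - E U' =
      (K e - K0) *m ((Z - Z') *m (Om + D) + (V0 + Z') *m (D - D'))
      - (M e - M0) *m (Z - Z') + K0 *m ((Z - Z') *m D + Z' *m (D - D')).
    have -> : (Z - Z') *m (Om + D) + (V0 + Z') *m (D - D') =
        (V0 + Z) *m (Om + D) - (V0 + Z') *m (Om + D').
      by rewrite mulmx_subE !addlK.
    rewrite -(mulmx_subE Z Z' D D') -(addlK _ _ V0 Z Z').
    rewrite /E -/Z -/Z' -/D -/D' !mulmxBr !opprD !opprK !addrA.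
    by rewrite [LHS](ACl (1 * 4 * 2 * 5 * 3 * 6)).
  set z := nrm (Z - Z'); set w := nrm (D - D').
  have z0 : 0 <= z by exact: nrm_ge0.
  have w0 : 0 <= w by exact: nrm_ge0.
  have [Z0 D0] := (nrm_ge0 (usubmx U), nrm_ge0 (dsubmx U)).
  have [Z'0 D'0] := (nrm_ge0 (usubmx U'), nrm_ge0 (dsubmx U')).
  apply: (@le_trans _ _ (a * e * (z * (o + 1) + (v + 1) * w) + a * e * z
      + k0 * (z * d + d * w))).
    apply: (addle); first apply: (addle).
    - apply: (mulle) => //; apply: (addle); apply: (mulle) => //; apply: (addle) => //.
        by rewrite /D; lra.
      by rewrite /Z'; lra.
    - by rewrite nrmN; exact: (mulle).
    - apply: (mulle) => //; apply: (addle); apply: (mulle) => //.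
        by rewrite /D; lra.
      by rewrite /Z'; lra.
  (* [3 + o + v] dominates the coefficient [o + 2] of [z] and the coefficient [v + 1] of [w]; [h1]
     and [h2] are the slack. *)
  have ae : 0 <= a * e by exact: mulr_ge0.
  have h1 : 0 <= a * e * z * (1 + v) by rewrite !mulr_ge0// addr_ge0.
  have h2 : 0 <= a * e * w * (2 + o) by rewrite !mulr_ge0// addr_ge0.
  by rewrite -subr_ge0; move: (addr_ge0 h1 h2); congr (0 <= _); ring.
pose F U := g (col_mx (E U) 0).
have gF U : nrm (F U) <= c * nrm (E U).
  by apply: le_trans (gc _) _; rewrite nrm_col_mx nrm0 addr0.
have F0 : nrm (F 0) <= c * a * (v * (1 + o)) * e.
  apply: le_trans (gF _) _; apply: le_trans (ler_wpM2l c0 hE0) _.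
  by rewrite le_eqVlt; apply/orP; left; apply/eqP; ring.
have [| |U FU hU] := @contraction_fixpoint _ _ F d; first by lra.
  move=> U U' hU hU'; rewrite /F -gB opp_col_mx add_col_mx subr0.
  apply: le_trans (gc _) _; rewrite nrm_col_mx nrm0 addr0.
  apply: le_trans (ler_wpM2l c0 (hE _ _ hU hU')) _.
  rewrite mulrCA; apply: ler_wpM2l; first exact: nrm_ge0.
  by rewrite mulrDr; move: es1 dck; lra.
exists (usubmx U), (dsubmx U); split; last 2 first.
- have := nrm_ge0 (dsubmx U); have := nrmU U; lra.
- have := nrm_ge0 (usubmx U); have := nrmU U; lra.
(* Since [g] inverts [f], the fixed point satisfies [f U = col_mx (E U) 0], whose top block is the
   wanted equation regrouped. *)
have := fg (col_mx (E U) 0); rewrite -/(F U) FU => /eq_col_mx[h _].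
move: h; rewrite /= /E; set Z := usubmx U; set Dl := dsubmx U => h.
have hZ : M0 *m Z = (K e - K0) *m ((V0 + Z) *m (Om + Dl))
    - (M e - M0) *m (V0 + Z) + K0 *m (Z *m Dl) + K0 *m V0 *m Dl + K0 *m Z *m Om.
  by rewrite -h !subrK.
have -> : M e *m (V0 + Z) = (M e - M0) *m (V0 + Z) + (M0 *m V0 + M0 *m Z).
  by rewrite -mulmxDr mulmxBl subrK.
rewrite hV0 hZ -[K e *m _ *m _]mulmxA -[in RHS](subrK K0 (K e)) [in RHS]mulmxDl.
have -> : K0 *m ((V0 + Z) *m (Om + Dl)) =
    K0 *m V0 *m Om + K0 *m (Z *m Dl) + K0 *m V0 *m Dl + K0 *m Z *m Om.
  rewrite mulmxA !mulmxDr !mulmxDl !mulmxA !addrA.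
  by rewrite [LHS](ACl (1 * 4 * 3 * 2)).
rewrite !addrA [LHS](ACl (3 * 2 * 5 * 6 * 7 * 1 * 4))/=.
by rewrite addrK.
Qed.
End Contraction.

(** * Sylvester equations and invariant subspaces *)

Section Deflation.
Variable F : fieldType.

Lemma mulmx_horner_intertwine m r (A : 'M[F]_m.+1) (B : 'M[F]_r.+1)
    (U : 'M[F]_(m.+1, r.+1)) (p : {poly F}) :
  A *m U = U *m B -> horner_mx A p *m U = U *m horner_mx B p.
Proof.
move=> AU; elim/poly_ind: p => [|p c IH]; first by rewrite !rmorph0 mul0mx mulmx0.
rewrite !rmorphD !rmorphM /= !horner_mx_X !horner_mx_C mulmxDl mulmxDr.
rewrite -[_ * A]/(_ *m A) -[_ * B]/(_ *m B) -mulmxA AU !mulmxA IH.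
by rewrite scalar_mxC.
Qed.

(** [U] intertwines each polynomial in [A] with the same polynomial in [B]. Evaluating a Bezout
    relation at [A] and using Cayley-Hamilton for both matrices annihilates [U]. *)
Lemma sylvester_eq0 m r (A : 'M[F]_m) (B : 'M[F]_r) (U : 'M[F]_(m, r)) :
  coprimep (char_poly A) (char_poly B) -> A *m U = U *m B -> U = 0.
Proof.
case: m A U => [|m] A U; first by rewrite !flatmx0.
case: r B U => [|r] B U; first by rewrite !thinmx0.
move=> /Bezout_eq1_coprimepP[[u v]/= uv] AU.
have := congr1 (fun p => horner_mx A p *m U) uv; rewrite /= rmorph1 mul1mx => <-.
rewrite rmorphD !rmorphM/= Cayley_Hamilton mulr0 add0r -[_ * _]/(_ *m _) -mulmxA.
by rewrite (mulmx_horner_intertwine _ AU) Cayley_Hamilton !mulmx0.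
Qed.

Lemma char_poly_similar m (A B X : 'M[F]_m) :
  X \in unitmx -> A *m X = X *m B -> char_poly A = char_poly B.
Proof.
move=> Xu AX; pose Y := map_mx (@polyC F) X.
have Y0 : \det Y != 0.
  by rewrite det_map_mx polyC_eq0 -unitfE -unitmxE.
apply: (mulIf Y0); rewrite [RHS]mulrC -!det_mulmx; congr (\det _).
rewrite mulmxBl mulmxBr scalar_mxC; congr (_ - _).
by rewrite -!map_mxM AX.
Qed.

Lemma char_poly_ublock m r (A : 'M[F]_m) (B : 'M[F]_(m, r)) (C : 'M[F]_r) :
  char_poly (block_mx A B 0 C) = char_poly A * char_poly C.
Proof.
rewrite /char_poly /char_poly_mx map_block_mx raddf0 scalar_mx_block.
by rewrite opp_block_mx add_block_mx subr0 sub0r det_ublock.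
Qed.

(* In a basis that starts with the columns of [Phi], [Theta] is block upper
   triangular with diagonal blocks similar to [Omega] and of characteristic
   polynomial [q]; the bottom block of [Psi] then solves a homogeneous Sylvester
   equation, and [P] reads off the top block. *)
Lemma deflating_complement m r (Theta : 'M[F]_m) (Phi : 'M[F]_(m, r))
    (Omega : 'M[F]_r) (q : {poly F}) :
  \rank Phi = r -> Theta *m Phi = Phi *m Omega ->
  char_poly Theta = char_poly Omega * q -> coprimep (char_poly Omega) q ->
  exists P : 'M[F]_(r, m), forall (Psi : 'M[F]_(m, r)) (Delta : 'M[F]_r),
    Theta *m Psi = Psi *m Omega + Phi *m Delta -> P *m Psi = 0 -> Psi = 0.
Proof.
move=> rk; have rm : (r <= m)%N by rewrite -rk rank_leq_row.
have [m' em] : exists m', m = (r + m')%N by exists (m - r)%N; rewrite subnKC.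
subst m; move=> TP ch co.
pose E := col_ebase Phi; pose Q := row_ebase Phi.
have Eu : E \in unitmx by exact: col_ebase_unit.
have Qu : Q \in unitmx by exact: row_ebase_unit.
pose T := invmx E *m Theta *m E.
(* Full column rank reduces the rank factorisation of [Phi] to the invertible [Q] on top of
   zeros. *)
have EPhi : invmx E *m Phi = col_mx Q 0.
  rewrite -[Phi in LHS]mulmx_ebase -/E -/Q rk -!mulmxA mulKmx//.
  by rewrite pid_mx_col mul_col_mx mul1mx mul0mx.
have TQ : T *m col_mx Q 0 = col_mx Q 0 *m Omega.
  by rewrite -EPhi /T -!mulmxA mulKVmx// TP !mulmxA.
move: TQ; rewrite -[T]submxK mul_block_col mul_col_mx !mulmx0 !addr0 mul0mx.
move=> /eq_col_mx[ulQ dl0].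
have {}dl0 : dlsubmx T = 0 by rewrite -[LHS](mulmxK Qu) dl0 mul0mx.
have chT : char_poly Theta = char_poly T.
  by apply: (char_poly_similar Eu); rewrite /T !mulmxA mulmxV ?mul1mx.
have chd : char_poly (drsubmx T) = q.
  move: ch; rewrite chT -{1}[T]submxK dl0 char_poly_ublock (char_poly_similar Qu ulQ).
  by move=> /(mulfI (monic_neq0 (char_poly_monic Omega))).
exists (usubmx (invmx E)) => Psi Delta TPsi; rewrite mul_usub_mx => P0.
rewrite -[Psi](mulKVmx Eu) -[invmx E *m Psi]vsubmxK P0.
suff -> : dsubmx (invmx E *m Psi) = 0 by rewrite col_mx0 mulmx0.
apply: (@sylvester_eq0 _ _ (drsubmx T) Omega); first by rewrite chd coprimep_sym.
have := congr1 (mulmx (invmx E)) TPsi.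
rewrite mulmxDr !mulmxA EPhi -[invmx E *m Theta](mulmxK Eu) -/T -(mulmxA T).
rewrite -[T]submxK dl0 -[invmx E *m Psi]vsubmxK P0 mul_block_col !mul_col_mx add_col_mx.
by rewrite !mul0mx !add0r addr0 block_mxKdr col_mxKd => /eq_col_mx[].
Qed.

End Deflation.

(** * Jordan coordinates *)

Section BlockBiorthogonality.
Variable F : fieldType.

Lemma mxcol_mxrow_eq1 n q (p : 'I_q -> nat) (C : forall j, 'M[F]_(p j, n))
    (B : forall j, 'M[F]_(n, p j)) :
  \mxcol_j C j *m \mxrow_j B j = 1%:M ->
  (forall j, C j *m B j = 1%:M) /\ (forall j j', j != j' -> C j *m B j' = 0).
Proof.
rewrite mul_mxcol_mxrow -(@mxdiagZ _ _ p) /mxdiag => /eq_mxblockP h.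
split=> [j|j j' jj']; first by rewrite h eqxx conform_mx_id.
by rewrite h (negPf jj').
Qed.

Lemma mxcol_mxrow_eq0 n q q' (p : 'I_q -> nat) (p' : 'I_q' -> nat)
    (C : forall j, 'M[F]_(p j, n)) (B : forall j, 'M[F]_(n, p' j)) :
  \mxcol_j C j *m \mxrow_j B j = 0 -> forall j j', C j *m B j' = 0.
Proof. by rewrite mul_mxcol_mxrow -mxblock0 => /eq_mxblockP. Qed.

End BlockBiorthogonality.

Section Coordinates.
Variable R : realType.

Lemma ctrE m p (B : 'M[R[i]]_(m, p)) a b : ctr B a b = (B b a)^*%C.
Proof. by rewrite /ctr !mxE. Qed.

Lemma ctrK m p (B : 'M[R[i]]_(m, p)) : ctr (ctr B) = B.
Proof. by apply/matrixP => a b; rewrite !ctrE conjcK. Qed.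

Lemma ctr_row_mx m p q (B : 'M[R[i]]_(m, p)) (C : 'M[R[i]]_(m, q)) :
  ctr (row_mx B C) = col_mx (ctr B) (ctr C).
Proof.
apply/matrixP => a b; rewrite ctrE !mxE.
by case: (fintype.split a) => j; rewrite ctrE.
Qed.

Lemma ctr_mxrow n q (p : 'I_q -> nat) (B : forall j, 'M[R[i]]_(n, p j)) :
  ctr (\mxrow_j B j) = \mxcol_j ctr (B j).
Proof. by apply/matrixP => a b; rewrite ctrE !mxE. Qed.

Lemma ctr_jordan_cols n k (s : nat -> nat)
    (X : forall j : nat, nat -> 'M[R[i]]_(n, s j)) :
  ctr (jordan_cols k X) = \mxcol_(j < k) \mxcol_(l < j.+1) ctr (X j.+1 l.+1).
Proof. by rewrite ctr_mxrow; apply: eq_mxcol => j; rewrite ctr_mxrow. Qed.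

Variables (n k c : nat) (s : nat -> nat) (hn : (jordan_dim k s + c)%N = n).
Variables (A : 'M[R[i]]_n) (lambda0 : R[i]).
Variables (Xi Sigma : forall j : nat, nat -> 'M[R[i]]_(n, s j)).
Variables (Xic Sigmac : 'M[R[i]]_(n, c)) (A22 : 'M[R[i]]_c).
Hypothesis hA : jordan_structure hn A lambda0 Xi Sigma Xic Sigmac A22.

(** Products with the rows of [ctr Sigma] and [ctr Sigmac] are the Jordan coordinates of a vector.
    The last two claims restate the similarity of [A] to its block form as identities for these
    rows. *)
Lemma jordan_blocks : let J := jordan_part k s lambda0 in
  [/\ col_mx (ctr (jordan_cols k Sigma)) (ctr Sigmac)
        *m row_mx (jordan_cols k Xi) Xic = 1%:M,
      jordan_cols k Xi *m ctr (jordan_cols k Sigma) + Xic *m ctr Sigmac = 1%:M,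
      ctr (jordan_cols k Sigma) *m A = J *m ctr (jordan_cols k Sigma) &
      ctr Sigmac *m A = A22 *m ctr Sigmac].
Proof.
move: hA => [_]; rewrite /full_cols; move: Xi Sigma Xic Sigmac A.
(* Replacing [n] by the sum of the dimensions removes the casts of [full_cols]. *)
case: n / hn => X S Xc Sc A'; rewrite !castmx_id /=.
set U := row_mx (jordan_cols k X) Xc => Uu.
move=> /(congr1 (@ctr R _ _)); rewrite ctrK ctr_row_mx => hS AU _.
have h : invmx U *m A' = block_mx (jordan_part k s lambda0) 0 0 A22 *m invmx U.
  by rewrite -[LHS](mulmxK Uu) -(mulmxA _ A') AU mulKmx.
move: h; rewrite -hS mul_col_mx mul_block_col !mul0mx addr0 add0r.
move=> /eq_col_mx[-> ->]; split=> //; first by rewrite hS mulVmx.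
by rewrite -mul_row_col hS mulmxV.
Qed.

Lemma biorthogonal j l : (0 < l <= j)%N -> (j <= k)%N ->
  ctr (Sigma j l) *m Xi j l = 1%:M.
Proof.
have [+ _ _ _] := jordan_blocks; rewrite mul_col_row scalar_mx_block.
move=> /eq_block_mx[+ _ _ _]; rewrite ctr_jordan_cols.
rewrite /jordan_cols /jordan_cols_at => /mxcol_mxrow_eq1[h _].
case: j l => [|j] [|l]// lj jk.
by have /mxcol_mxrow_eq1[+ _] := h (Ordinal jk); move/(_ (Ordinal lj)).
Qed.

Lemma biorthogonal0 j l j' l' : (0 < l <= j)%N -> (j <= k)%N ->
  (0 < l' <= j')%N -> (j' <= k)%N -> (j != j') || (l != l') ->
  ctr (Sigma j l) *m Xi j' l' = 0.
Proof.
have [+ _ _ _] := jordan_blocks; rewrite mul_col_row scalar_mx_block.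
move=> /eq_block_mx[+ _ _ _]; rewrite ctr_jordan_cols.
rewrite /jordan_cols /jordan_cols_at => /mxcol_mxrow_eq1[h h0].
case: j l j' l' => [|j] [|l] [|j'] [|l']// lj jk lj' jk'.
have [ejj'|jj' _] := eqVneq j j'; last first.
  have /mxcol_mxrow_eq0 := h0 (Ordinal jk) (Ordinal jk') jj'.
  by move=> /(_ (Ordinal lj) (Ordinal lj')).
subst j'; rewrite eqxx/= => ll'.
have /mxcol_mxrow_eq1[_] := h (Ordinal jk).
by move=> /(_ (Ordinal lj) (Ordinal lj')); apply.
Qed.

Lemma biorthogonal_compl j l : (0 < l <= j)%N -> (j <= k)%N ->
  ctr Sigmac *m Xi j l = 0 /\ ctr (Sigma j l) *m Xic = 0.
Proof.
have [+ _ _ _] := jordan_blocks; rewrite mul_col_row scalar_mx_block.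
move=> /eq_block_mx[_ + + _]; rewrite ctr_jordan_cols /jordan_cols /jordan_cols_at => h1 h2.
case: j l => [|j] [|l]// lj jk; split.
  move: h2; rewrite mul_mxrow -mxrow0 => /eq_mxrowP/(_ (Ordinal jk)).
  by rewrite mul_mxrow -mxrow0 => /eq_mxrowP/(_ (Ordinal lj)).
move: h1; rewrite mxcol_mul -mxcol0 => /eq_mxcolP/(_ (Ordinal jk)).
by rewrite mxcol_mul -mxcol0 => /eq_mxcolP/(_ (Ordinal lj)).
Qed.

Lemma biorthogonal_compl1 : ctr Sigmac *m Xic = 1%:M.
Proof.
have [+ _ _ _] := jordan_blocks; rewrite mul_col_row scalar_mx_block.
by move=> /eq_block_mx[_ _ _].
Qed.

Lemma resolution_of_identity :
  \sum_(j < k) \sum_(l < j.+1) Xi j.+1 l.+1 *m ctr (Sigma j.+1 l.+1)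
    + Xic *m ctr Sigmac = 1%:M.
Proof.
have [_ <- _ _] := jordan_blocks; rewrite ctr_jordan_cols mul_mxrow_mxcol.
by congr (_ + _); apply: eq_bigr => j _; rewrite mul_mxrow_mxcol.
Qed.

(** The superdiagonal identities, acting on rows from the left, fetch the next row of the chain;
    there is none after the last. *)
Lemma dual_chain j l : (0 < l <= j)%N -> (j <= k)%N ->
  ctr (Sigma j l) *m (A - lambda0%:M) = if (l < j)%N then ctr (Sigma j l.+1) else 0.
Proof.
have [_ _ + _] := jordan_blocks; rewrite ctr_jordan_cols => h.
have {h} : \mxcol_(j < k) \mxcol_(l < j.+1) ctr (Sigma j.+1 l.+1)
      *m (A - lambda0%:M) =
    \mxdiag_(j < k) nilp_block R s j.+1
      *m \mxcol_(j < k) \mxcol_(l < j.+1) ctr (Sigma j.+1 l.+1).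
  by rewrite mulmxBr h mulmxDl scalar_mxC addrAC subrr add0r.
rewrite mul_mxdiag_mxcol mxcol_mul => /eq_mxcolP h.
case: j l => [|j] [|l]// lj jk; move: (h (Ordinal jk)).
rewrite mul_mxblock_mxrow mxcol_mul => /eq_mxcolP/(_ (Ordinal lj)) /= ->.
case: ifPn => [lj'|]; last first.
  rewrite -leqNgt => jl; rewrite big1// => b _; rewrite ifN ?mul0mx//.
  by apply/eqP => e; move: (ltn_ord b); rewrite e ltnNge jl.
rewrite (bigD1 (Ordinal lj'))//= eqxx mul1mx big1 ?addr0// => b bl.
by rewrite ifN ?mul0mx.
Qed.

Lemma dual_compl : ctr Sigmac *m (A - lambda0%:M) = (A22 - lambda0%:M) *m ctr Sigmac.
Proof.
by have [_ _ _ h] := jordan_blocks; rewrite mulmxBr h mulmxBl scalar_mxC.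
Qed.

End Coordinates.

(** * The leading columns *)

Section LeadingColumns.
Variables (R : realType) (n k c : nat) (s : nat -> nat).
Variables (hn : (jordan_dim k s + c)%N = n).
Variables (A D : 'M[R[i]]_n) (lambda0 : R[i]).
Variables (Xi Sigma : forall j : nat, nat -> 'M[R[i]]_(n, s j)).
Variables (Xic Sigmac : 'M[R[i]]_(n, c)) (A22 : 'M[R[i]]_c).
Hypothesis hA : jordan_structure hn A lambda0 Xi Sigma Xic Sigmac A22.
Hypothesis hW : forall i : nat, (1 <= i <= k)%N -> Wmx k D Xi Sigma i \in unitmx.

Lemma coords_inj p (V V' : 'M[R[i]]_(n, p)) :
  (forall j l, (0 < l <= j)%N -> (j <= k)%N ->
     ctr (Sigma j l) *m V = ctr (Sigma j l) *m V') ->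
  ctr Sigmac *m V = ctr Sigmac *m V' -> V = V'.
Proof.
move=> h hc; rewrite -[V]mul1mx -[V']mul1mx -(resolution_of_identity hA).
rewrite !mulmxDl !mulmx_suml -!mulmxA hc; congr (_ + _).
apply: eq_bigr => j _; rewrite !mulmx_suml; apply: eq_bigr => l _.
by rewrite -!mulmxA h//=.
Qed.

Definition from_coords p (Y : forall j : nat, nat -> 'M[R[i]]_(s j, p))
    (Yc : 'M[R[i]]_(c, p)) : 'M[R[i]]_(n, p) :=
  \sum_(j < k) \sum_(l < j.+1) Xi j.+1 l.+1 *m Y j.+1 l.+1 + Xic *m Yc.

Lemma from_coordsK p (Y : forall j : nat, nat -> 'M[R[i]]_(s j, p))
    (Yc : 'M[R[i]]_(c, p)) j l : (0 < l <= j)%N -> (j <= k)%N ->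
  ctr (Sigma j l) *m from_coords Y Yc = Y j l.
Proof.
move=> lj jk.
rewrite mulmxDr mulmxA (proj2 (biorthogonal_compl hA _ _))// mul0mx addr0.
case: j l lj jk => [|j] [|l]// lj jk.
rewrite mulmx_sumr (bigD1 (Ordinal jk))//= mulmx_sumr (bigD1 (Ordinal lj))//=.
rewrite mulmxA (biorthogonal hA)// mul1mx big1 ?addr0 => [|l' ll'].
  rewrite big1 ?addr0// => j' jj'; rewrite mulmx_sumr big1// => l' _.
  rewrite mulmxA (biorthogonal0 hA) ?mul0mx//=.
  by apply/orP; left; rewrite eq_sym eqSS.
rewrite mulmxA (biorthogonal0 hA) ?mul0mx//= eqxx/=.
by rewrite eq_sym eqSS.
Qed.

Lemma from_coords_compl p (Y : forall j : nat, nat -> 'M[R[i]]_(s j, p))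
    (Yc : 'M[R[i]]_(c, p)) : ctr Sigmac *m from_coords Y Yc = Yc.
Proof.
rewrite mulmxDr mulmxA (biorthogonal_compl1 hA) mul1mx mulmx_sumr big1 ?add0r//.
move=> j _; rewrite mulmx_sumr big1// => l _; rewrite mulmxA.
by rewrite (proj1 (biorthogonal_compl hA _ _)) ?mul0mx//=.
Qed.

Lemma ctr_last_cols i :
  ctr (last_cols k Sigma i) = \mxcol_(a < k.+1 - i) ctr (Sigma (i + a)%N (i + a)%N).
Proof. exact: ctr_mxrow. Qed.

Lemma first_cols_coords p i (X : 'M[R[i]]_(n, p)) : (0 < i)%N ->
  (forall j l, (0 < l <= j)%N -> (j <= k)%N -> (l != 1%N) || (j < i)%N ->
     ctr (Sigma j l) *m X = 0) ->
  ctr Sigmac *m X = 0 ->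
  X = first_cols k Xi i *m \mxcol_(a < k.+1 - i) (ctr (Sigma (i + a)%N 1%N) *m X).
Proof.
move=> i0 h hc; rewrite /first_cols mul_mxrow_mxcol; apply: coords_inj; last first.
  rewrite hc mulmx_sumr big1// => a _; rewrite mulmxA.
  by rewrite (proj1 (biorthogonal_compl hA _ _)) ?mul0mx//; have := ltn_ord a; lia.
move=> j l lj jk; rewrite mulmx_sumr.
have [|] := boolP ((l != 1%N) || (j < i)%N) => hjl.
  rewrite h// big1// => a _; rewrite mulmxA (biorthogonal0 hA) ?mul0mx//.
  - lia.
  - by have := ltn_ord a; lia.
  - by move: hjl; lia.
have [a ej] : exists a, j = (i + a)%N by exists (j - i)%N; lia.
have el : l = 1%N by move: hjl; lia.
subst j l; have ak : (a < k.+1 - i)%N by lia.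
rewrite (bigD1 (Ordinal ak))//= mulmxA (biorthogonal hA)// mul1mx big1 ?addr0//.
move=> b ba; rewrite mulmxA (biorthogonal0 hA) ?mul0mx//.
- lia.
- by have := ltn_ord b; lia.
- rewrite eqn_add2l orbF; apply: contra ba => /eqP e.
  by apply/eqP/val_inj.
Qed.

(** By the vanishing coordinates, [X] is [first_cols k Xi i] times some [y]; the condition on [D]
    then reads [Wmx k D Xi Sigma i *m y = 0]. *)
Lemma Wmx_inj p i (X : 'M[R[i]]_(n, p)) : (0 < i)%N ->
  (forall j l, (0 < l <= j)%N -> (j <= k)%N -> (l != 1%N) || (j < i)%N ->
     ctr (Sigma j l) *m X = 0) ->
  ctr Sigmac *m X = 0 ->
  (forall j, (i <= j <= k)%N -> ctr (Sigma j j) *m (D *m X) = 0) -> X = 0.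
Proof.
move=> i0 h hc hD; have e := first_cols_coords i0 h hc; rewrite e.
(* The case [i = k.+1] is needed later for [rho = k]; then [first_cols] has no columns. *)
have [ik|ki] := leqP i k; last first.
  have e0 : (k.+1 - i = 0)%N by lia.
  have e1 : (\sum_(j < k.+1 - i) s (i + j) = 0)%N by rewrite big1// => -[a /=]; rewrite e0.
  apply/matrixP => x y; rewrite !mxE big1// => a _.
  by have := ltn_ord a; rewrite [X in (_ < X)%N]e1.
have Wu : Wmx k D Xi Sigma i \in unitmx by rewrite hW// i0.
rewrite -[X in _ *m X](mulKmx Wu) {1}/Wmx -!mulmxA -e.
suff -> : ctr (last_cols k Sigma i) *m (D *m X) = 0 by rewrite !mulmx0.
rewrite ctr_last_cols mxcol_mul -mxcol0; apply/eq_mxcolP => a.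
by apply: hD; have := ltn_ord a; lia.
Qed.

Variable rho : nat.
Hypotheses (hrho1 : (0 < rho)%N) (hrhok : (rho <= k)%N).
Let lead := leading_cols k D Xi Sigma rho.

Lemma leading_colsE : lead = Xi rho 1%N + first_cols k Xi rho.+1 *m Gmx k D Xi Sigma rho.
Proof. by rewrite /lead /leading_cols mul_row_col mulmx1. Qed.

Lemma dual_first_cols0 j l i : (0 < i)%N -> (0 < l <= j)%N -> (j <= k)%N ->
  (l != 1%N) || (j < i)%N -> ctr (Sigma j l) *m first_cols k Xi i = 0.
Proof.
move=> i0 lj jk h; rewrite mul_mxrow -mxrow0; apply/eq_mxrowP => a.
have := ltn_ord a => ha; rewrite (biorthogonal0 hA)//; [lia|lia|].
by move: h; lia.
Qed.

Lemma leading_cols_coord0 j l : (0 < l <= j)%N -> (j <= k)%N ->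
  (l != 1%N) || (j < rho)%N -> ctr (Sigma j l) *m lead = 0.
Proof.
move=> lj jk h; rewrite leading_colsE mulmxDr mulmxA dual_first_cols0//; last lia.
rewrite mul0mx addr0 (biorthogonal0 hA) ?hrho1//.
by move: h; lia.
Qed.

Lemma leading_cols_coord1 : ctr (Sigma rho 1%N) *m lead = 1%:M.
Proof.
rewrite leading_colsE mulmxDr mulmxA dual_first_cols0 ?mul0mx ?addr0//.
  by rewrite (biorthogonal hA).
by rewrite ltnSn orbT.
Qed.

Lemma leading_cols_compl : ctr Sigmac *m lead = 0.
Proof.
rewrite leading_colsE mulmxDr mulmxA (proj1 (biorthogonal_compl hA _ _))// add0r.
suff -> : ctr Sigmac *m first_cols k Xi rho.+1 = 0 by rewrite mul0mx.
rewrite mul_mxrow -mxrow0; apply/eq_mxrowP => a; have := ltn_ord a => ha.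
by rewrite (proj1 (biorthogonal_compl hA _ _))//; lia.
Qed.

Lemma leading_cols_S : ctr (Sigma rho rho) *m (D *m lead) = Smx k D Xi Sigma rho.
Proof. by rewrite leading_colsE /Smx !mulmxDr !mulmxA. Qed.

(** These are the equations that define [G_rho^(rho)], read off block by block. *)
Lemma leading_cols_W j : (rho < j <= k)%N -> ctr (Sigma j j) *m (D *m lead) = 0.
Proof.
clear hA hn hrho1 hrhok; move=> hj.
have Wu : Wmx k D Xi Sigma rho.+1 \in unitmx by rewrite hW//; lia.
have : ctr (last_cols k Sigma rho.+1) *m (D *m lead) = 0.
  rewrite leading_colsE !mulmxDr !mulmxA -/(Wmx k D Xi Sigma rho.+1) /Gmx.
  by rewrite mulmxN mulKVmx// subrr.
have [a ej] : exists a, j = (rho.+1 + a)%N by exists (j - rho.+1)%N; lia.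
subst j; have ak : (a < k.+1 - rho.+1)%N by lia.
by rewrite ctr_last_cols mxcol_mul -mxcol0 => /eq_mxcolP/(_ (Ordinal ak)).
Qed.

(** [S_rho] is the Schur complement of [W_(rho+1)] in [W_rho], so it inherits the invertibility of
    [W_rho]. *)
Lemma Smx_inj p (x : 'M[R[i]]_(s rho, p)) : Smx k D Xi Sigma rho *m x = 0 -> x = 0.
Proof.
move=> Sx; suff h : lead *m x = 0.
  by rewrite -[x]mul1mx -leading_cols_coord1 -mulmxA h mulmx0.
apply: (Wmx_inj hrho1) => [j l lj jk h| |j].
- by rewrite mulmxA leading_cols_coord0 ?mul0mx.
- by rewrite mulmxA leading_cols_compl mul0mx.
rewrite leq_eqVlt => /andP[/orP[/eqP <- _|rj jk]]; rewrite [D *m _]mulmxA [LHS]mulmxA.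
  by rewrite leading_cols_S.
by rewrite leading_cols_W ?mul0mx// rj.
Qed.

(** The difference of the two sides also lacks the coordinate [(rho, 1)], so [Wmx_inj] applies to it
    with [i = rho.+1]. *)
Lemma leading_cols_unique p (X : 'M[R[i]]_(n, p)) :
  (forall j l, (0 < l <= j)%N -> (j <= k)%N -> (l != 1%N) || (j < rho)%N ->
     ctr (Sigma j l) *m X = 0) ->
  ctr Sigmac *m X = 0 ->
  (forall j, (rho < j <= k)%N -> ctr (Sigma j j) *m (D *m X) = 0) ->
  X = lead *m (ctr (Sigma rho 1%N) *m X).
Proof.
move=> h hc hD; apply/eqP; rewrite -subr_eq0; apply/eqP.
apply: (@Wmx_inj _ rho.+1) => // [j l lj jk hjl| |j hj].
- rewrite mulmxBr; have [hjl'|hjl'] := boolP ((l != 1%N) || (j < rho)%N).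
    by rewrite (h j l)// [X in _ - X]mulmxA leading_cols_coord0// mul0mx subrr.
  have [ej el] : j = rho /\ l = 1%N by move: hjl hjl'; lia.
  by rewrite ej el [X in _ - X]mulmxA leading_cols_coord1 mul1mx subrr.
- by rewrite mulmxBr hc [X in _ - X]mulmxA leading_cols_compl mul0mx subrr.
- rewrite !mulmxBr hD// [D *m (lead *m _)]mulmxA [X in _ - X]mulmxA.
  by rewrite leading_cols_W// mul0mx subrr.
Qed.

End LeadingColumns.

(** * Scaling and the limit problem *)

Section LipschitzAtZero.
Variable R : realType.

(** Only comparison with the value at 0 is required, as in the hypothesis on [M] and [K] of
    [deflating_subspace_perturbation]. *)
Definition lipschitz_at0 m p (F : R -> 'M[R[i]]_(m, p)) : Prop :=
  exists2 a, 0 <= a & forall e, 0 <= e <= 1 -> nrm (F e - F 0) <= a * e.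

Lemma lipschitz_at0_cst m p (B : 'M[R[i]]_(m, p)) : lipschitz_at0 (fun=> B).
Proof. by exists 0 => // e _; rewrite subrr nrm0 mul0r. Qed.

Lemma lipschitz_at0D m p (F G : R -> 'M[R[i]]_(m, p)) :
  lipschitz_at0 F -> lipschitz_at0 G -> lipschitz_at0 (fun e => F e + G e).
Proof.
move=> [a a0 hF] [b b0 hG]; exists (a + b); first exact: addr_ge0.
move=> e he; rewrite opprD addrACA mulrDl; apply: le_trans (nrmD _ _) _.
by apply: lerD; [exact: hF|exact: hG].
Qed.

Lemma lipschitz_at0M m p q (F : R -> 'M[R[i]]_(m, p)) (G : R -> 'M[R[i]]_(p, q)) :
  lipschitz_at0 F -> lipschitz_at0 G -> lipschitz_at0 (fun e => F e *m G e).
Proof.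
move=> [a a0 hF] [b b0 hG]; exists (a * (nrm (G 0) + b) + nrm (F 0) * b).
  by rewrite addr_ge0 ?mulr_ge0 ?addr_ge0 ?nrm_ge0.
move=> e he; have /andP[e0 e1] := he.
rewrite mulmx_subE mulrDl; apply: le_trans (nrmD _ _) _; apply: lerD.
  rewrite mulrAC; apply: le_trans (nrmM _ _) _.
  apply: ler_pM; [exact: nrm_ge0|exact: nrm_ge0|exact: hF|].
  rewrite -[G e](subrK (G 0)) addrC; apply: le_trans (nrmD _ _) _.
  apply: lerD => //; apply: le_trans (hG _ he) _.
  by rewrite -[leRHS]mulr1 ler_wpM2l.
rewrite -mulrA; apply: le_trans (nrmM _ _) _.
by apply: ler_wpM2l; [exact: nrm_ge0|exact: hG].
Qed.

Lemma lipschitz_at0_sum m p (I : finType) (F : I -> R -> 'M[R[i]]_(m, p)) :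
  (forall i, lipschitz_at0 (F i)) -> lipschitz_at0 (fun e => \sum_i F i e).
Proof.
move=> h; have {}h i : exists a, 0 <= a /\ forall e, 0 <= e <= 1 ->
    nrm (F i e - F i 0) <= a * e by have [a a0 ha] := h i; exists a.
have [a ha] := boolp.choice h.
exists (\sum_i a i) => [|e he]; first by apply: sumr_ge0 => i _; case: (ha i).
rewrite -sumrB mulr_suml.
apply: (@le_trans _ _ (\sum_i nrm (F i e - F i 0))); last first.
  by apply: ler_sum => i _; apply: (ha i).2.
elim/big_ind2: _ => [|x1 x2 y1 y2 h1 h2|//]; first by rewrite nrm0.
exact: le_trans (nrmD _ _) (lerD h1 h2).
Qed.

Lemma lipschitz_at0_exp m p (d : nat) (B : 'M[R[i]]_(m, p)) :
  lipschitz_at0 (fun e => (e ^+ d)%:C *: B).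
Proof.
case: d => [|d]; first exact: (lipschitz_at0_cst (1%:C *: B)).
exists (nrm B) => [|e /andP[e0 e1]]; first exact: nrm_ge0.
rewrite expr0n/= scale0r subr0 nrmZ ?exprn_ge0// mulrC.
apply: ler_wpM2l; first exact: nrm_ge0.
by rewrite exprS -[leRHS]mulr1 ler_wpM2l// exprn_ile1.
Qed.

End LipschitzAtZero.

(** * Diagonal scalings in Jordan coordinates *)

Section Scaling.
Variables (R : realType) (n k c : nat) (s : nat -> nat).
Variables (hn : (jordan_dim k s + c)%N = n).
Variables (A : 'M[R[i]]_n) (lambda0 : R[i]).
Variables (Xi Sigma : forall j : nat, nat -> 'M[R[i]]_(n, s j)).
Variables (Xic Sigmac : 'M[R[i]]_(n, c)) (A22 : 'M[R[i]]_c).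
Hypothesis hA : jordan_structure hn A lambda0 Xi Sigma Xic Sigmac A22.

(* Locked, so that unification does not unfold the sums. *)
Definition scaling (w : nat -> nat -> nat) (wc : nat) (e : R) : 'M[R[i]]_n :=
  locked (from_coords k Xi Xic (fun j l => (e ^+ w j l)%:C *: ctr (Sigma j l))
    ((e ^+ wc)%:C *: ctr Sigmac)).

Lemma scaling_coord w wc e j l p (V : 'M[R[i]]_(n, p)) :
  (0 < l <= j)%N -> (j <= k)%N ->
  ctr (Sigma j l) *m (scaling w wc e *m V) = (e ^+ w j l)%:C *: (ctr (Sigma j l) *m V).
Proof. by move=> lj jk; rewrite /scaling -lock mulmxA (from_coordsK hA)// -scalemxAl. Qed.

Lemma scaling_compl w wc e p (V : 'M[R[i]]_(n, p)) :
  ctr Sigmac *m (scaling w wc e *m V) = (e ^+ wc)%:C *: (ctr Sigmac *m V).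
Proof. by rewrite /scaling -lock mulmxA (from_coords_compl hA)// -scalemxAl. Qed.

Lemma scaling0_coord w wc j l p (V : 'M[R[i]]_(n, p)) :
  (0 < l <= j)%N -> (j <= k)%N ->
  ctr (Sigma j l) *m (scaling w wc 0 *m V) =
    if w j l == 0%N then ctr (Sigma j l) *m V else 0.
Proof.
move=> lj jk; rewrite scaling_coord// expr0n.
by case: eqP; rewrite ?scale1r ?scale0r.
Qed.

Lemma scaling0_compl w wc p (V : 'M[R[i]]_(n, p)) :
  ctr Sigmac *m (scaling w wc 0 *m V) = if wc == 0%N then ctr Sigmac *m V else 0.
Proof.
by rewrite scaling_compl// expr0n; case: eqP; rewrite ?scale1r ?scale0r.
Qed.

Lemma scaling_lipschitz w wc : lipschitz_at0 (scaling w wc).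
Proof.
rewrite /scaling; under boolp.eq_fun do rewrite -lock.
apply: lipschitz_at0D; last first.
  by apply: lipschitz_at0M; [exact: lipschitz_at0_cst|exact: lipschitz_at0_exp].
apply: (@lipschitz_at0_sum _ _ _ _ (fun j e => _)) => j.
apply: (@lipschitz_at0_sum _ _ _ _ (fun j e => _)) => l.
by apply: lipschitz_at0M; [exact: lipschitz_at0_cst|exact: lipschitz_at0_exp].
Qed.

End Scaling.

(** * The scaled equation and its limit *)

Section ScaledProblem.
Variables (R : realType) (n k c : nat) (s : nat -> nat).
Variables (hn : (jordan_dim k s + c)%N = n).
Variables (A D : 'M[R[i]]_n) (lambda0 : R[i]).
Variables (Xi Sigma : forall j : nat, nat -> 'M[R[i]]_(n, s j)).
Variables (Xic Sigmac : 'M[R[i]]_(n, c)) (A22 : 'M[R[i]]_c).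
Hypothesis hA : jordan_structure hn A lambda0 Xi Sigma Xic Sigmac A22.
Hypothesis hW : forall i : nat, (1 <= i <= k)%N -> Wmx k D Xi Sigma i \in unitmx.
Variable rho : nat.
Hypotheses (hrho1 : (0 < rho)%N) (hrhok : (rho <= k)%N).
Let lead := leading_cols k D Xi Sigma rho.
Let S := Smx k D Xi Sigma rho.

(* Row (j, l) of the eigenvalue equation is divided by e ^+ wexp j l.+1, also for
   l = j: A - lambda0 I maps the coordinate (j, l.+1) to the row (j, l), so that it
   is left unchanged by the scaling. *)
Definition wexp (j l : nat) : nat :=
  if (rho <= j)%N then minn l.-1 rho else (rho - (j.+1 - l))%N.

Definition vscale : R -> 'M[R[i]]_n := scaling k Xi Sigma Xic Sigmac wexp rho.
(** The exponents here and in [pencilK] are what the row division leaves of [e ^+ rho] in front of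
    [D] and of [e] in front of [G]. The natural subtractions are exact: [wexp] is at most [rho] and
    grows by at most one with [l]. The complementary row is divided by [e ^+ rho]. *)
Definition rscale : R -> 'M[R[i]]_n :=
  scaling k Xi Sigma Xic Sigmac (fun j l => rho - wexp j l.+1)%N 0.
Definition pencilK : R -> 'M[R[i]]_n :=
  scaling k Xi Sigma Xic Sigmac (fun j l => (wexp j l).+1 - wexp j l.+1)%N 1.
Definition pencilM (e : R) : 'M[R[i]]_n :=
  A - lambda0%:M + rscale e *m D *m vscale e.

Lemma pencilM_coord e j l p (V : 'M[R[i]]_(n, p)) : (0 < l <= j)%N -> (j <= k)%N ->
  ctr (Sigma j l) *m (pencilM e *m V) =
    (if (l < j)%N then ctr (Sigma j l.+1) *m V else 0) +
    (e ^+ (rho - wexp j l.+1))%:C *: (ctr (Sigma j l) *m (D *m (vscale e *m V))).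
Proof.
move=> lj jk; rewrite /pencilM mulmxDl mulmxDr; congr (_ + _).
  by rewrite mulmxA (dual_chain hA)//; case: ifP; rewrite ?mul0mx.
by rewrite -!mulmxA (scaling_coord hA).
Qed.

Lemma pencilM_compl e p (V : 'M[R[i]]_(n, p)) :
  ctr Sigmac *m (pencilM e *m V) = (A22 - lambda0%:M) *m (ctr Sigmac *m V) +
    ctr Sigmac *m (D *m (vscale e *m V)).
Proof.
rewrite /pencilM mulmxDl mulmxDr; congr (_ + _).
  by rewrite mulmxA (dual_compl hA) -mulmxA.
by rewrite -!mulmxA (scaling_compl hA) scale1r.
Qed.

(** Multiplying row [(j, l)] by [e ^+ wexp j l.+1] and the complementary row by [e ^+ rho] undoes
    the division. *)
Lemma unscale e p (V : 'M[R[i]]_(n, p)) (G : 'M[R[i]]_p) :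
  pencilM e *m V = pencilK e *m V *m G ->
  (A + (e ^+ rho)%:C *: D) *m (vscale e *m V) =
    vscale e *m V *m (lambda0%:M + e%:C *: G).
Proof.
move=> h; have {}h := etrans h (esym (mulmxA _ _ _)).
rewrite mulmxDr mul_mx_scalar -scalemxAr.
suff h' : (A - lambda0%:M) *m (vscale e *m V) + (e ^+ rho)%:C *: D *m (vscale e *m V) =
    e%:C *: (vscale e *m V *m G).
  by rewrite -h' addrA -[lambda0 *: _]mul_scalar_mx -mulmxDl [_%:M + _]addrC subrK mulmxDl.
apply: (coords_inj hA) => [j l lj jk|].
  have {h} : (e ^+ wexp j l.+1)%:C *: (ctr (Sigma j l) *m (pencilM e *m V)) =
      (e ^+ wexp j l.+1)%:C *: (ctr (Sigma j l) *m (pencilK e *m (V *m G))) by rewrite h.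
  rewrite pencilM_coord// (scaling_coord hA)// scalerDr !scalerA.
  rewrite -!rmorphM -!exprD.
  have -> : (wexp j l.+1 + (rho - wexp j l.+1) = rho)%N.
    by rewrite subnKC// /wexp; case: ifP => _; lia.
  have -> : (wexp j l.+1 + ((wexp j l).+1 - wexp j l.+1) = (wexp j l).+1)%N.
    by rewrite subnKC// /wexp; case: ifP => _; lia.
  move=> h; rewrite mulmxDr mulmxA (dual_chain hA)// -scalemxAl -scalemxAr.
  rewrite -[RHS]scalemxAr -[vscale e *m V *m G]mulmxA (scaling_coord hA)// scalerA.
  rewrite -rmorphM -exprS -h; congr (_ + _).
  case: ifP => lj'; last by rewrite mul0mx scaler0.
  by rewrite (scaling_coord hA).
have {h} : (e ^+ rho)%:C *: (ctr Sigmac *m (pencilM e *m V)) =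
    (e ^+ rho)%:C *: (ctr Sigmac *m (pencilK e *m (V *m G))) by rewrite h.
rewrite pencilM_compl (scaling_compl hA) scalerDr scalerA -rmorphM -exprD.
rewrite addn1 => h.
rewrite mulmxDr mulmxA (dual_compl hA) -!mulmxA (scaling_compl hA).
rewrite -scalemxAl -[RHS]scalemxAr (scaling_compl hA) -!scalemxAr scalerA.
by rewrite -rmorphM -exprS -h.
Qed.

Lemma theta_mxcol p (psi : nat -> 'M[R[i]]_(s rho, p)) :
  Thetamx k D Xi Sigma rho *m \mxcol_(a < rho) psi a =
  \mxcol_(a < rho) (if (a.+1 < rho)%N then psi a.+1 else S *m psi 0%N).
Proof.
rewrite mul_mxblock_mxrow; apply/eq_mxcolP => a.
case: ifPn => [ar|ar].
  rewrite (bigD1 (Ordinal ar))//= eqxx mul1mx big1 ?addr0// => b bar.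
  rewrite ifN//; case: ifP => [|_]; last by rewrite mul0mx.
  by move=> /andP[/eqP e]; move: (ar); rewrite {1}e ltnn.
have ea : a.+1 = rho by apply/eqP; rewrite eqn_leq ltn_ord leqNgt ar.
rewrite (bigD1 (Ordinal hrho1))//= ea !eqxx/= big1 ?addr0//.
move=> b b0; rewrite ifN; last by rewrite neq_ltn ltn_ord.
by rewrite ifN ?mul0mx//.
Qed.

Variables (r : nat) (Om : 'M[R[i]]_r) (Phi : 'M[R[i]]_(\sum_(a < rho) s rho, r)).
Hypothesis hrank : \rank Phi = r.
Hypothesis hPhi : Thetamx k D Xi Sigma rho *m Phi = Phi *m Om.
Variable Q : 'M[R[i]]_(s rho, r).
Hypothesis hQ : Q = submxcol Phi (Ordinal hrho1).

(** The superdiagonal rows of [hPhi] make each block the previous one times [Om]; the last row gives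
    the equation for [S]. *)
Lemma krylov_blocks :
  Phi = \mxcol_(a < rho) (Q *m Om ^+ a) /\ S *m Q = Q *m Om ^+ rho.
Proof.
pose phi a := if insub a is Some i then submxcol Phi i else 0.
have phiE (a : 'I_rho) : phi a = submxcol Phi a by rewrite /phi valK.
have ePhi : Phi = \mxcol_(a < rho) phi a.
  by rewrite -[LHS]submxcolK; apply: eq_mxcol => a; rewrite phiE.
have phi0 : phi 0%N = Q by rewrite hQ -phiE.
have := hPhi; rewrite ePhi theta_mxcol mxcol_mul => /eq_mxcolP h.
have phiS a : (a < rho)%N -> phi a = Q *m Om ^+ a.
  elim: a => [_|a IH ar]; first by rewrite expr0 -[1]/(1%:M) mulmx1.
  have := h (Ordinal (ltnW ar)); rewrite /= ar => ->.
  by rewrite IH ?(ltnW ar)// exprSr -[_ * _]/(_ *m _) mulmxA.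
split; first by apply: eq_mxcol => a; rewrite phiS.
have ar : (rho.-1 < rho)%N by rewrite prednK.
have := h (Ordinal ar); rewrite /= prednK// ltnn phi0 => ->.
by rewrite phiS// -mulmxA -[_ *m Om]/(_ * _) -exprSr prednK.
Qed.

Lemma Phi_inj p (x : 'M[R[i]]_(r, p)) : Phi *m x = 0 -> x = 0.
Proof.
have : row_full Phi by rewrite /row_full hrank.
by move=> /row_fullP[B BP] h; rewrite -[x]mul1mx -BP -mulmxA h mulmx0.
Qed.

(** If [Om *m x = 0] then [S *m Q *m x = Q *m Om ^+ rho *m x = 0], so [Q *m x = 0] as [S] is
    injective. All blocks of [Phi *m x] then vanish, and [Phi] has full column rank. *)
Lemma Om_unit : Om \in unitmx.
Proof.
rewrite -row_full_unit -cokermx_eq0; apply/eqP/Phi_inj.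
have [-> SQ] := krylov_blocks; set x := cokermx Om.
have Ox : Om *m x = 0 by exact: mulmx_coker.
have Omx m : (0 < m)%N -> Om ^+ m *m x = 0.
  by case: m => // m _; rewrite exprSr -[_ * _]/(_ *m _) -mulmxA Ox mulmx0.
have Qx : Q *m x = 0.
  by apply: (Smx_inj hA hW hrho1 hrhok); rewrite mulmxA SQ -mulmxA Omx ?mulmx0.
rewrite mxcol_mul -mxcol0; apply: eq_mxcol => -[[|a] ar]/=.
  by rewrite expr0 -[1]/(1%:M) mulmx1.
by rewrite -mulmxA Omx ?mulmx0.
Qed.

Lemma A22_unit : A22 - lambda0%:M \in unitmx.
Proof.
have [_ _ _ _] := hA; rewrite /eigenvalue negbK => h.
by rewrite -row_free_unit -kermx_eq0.
Qed.

(** * An explicit solution of the limit problem *)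

Let B := lead *m Q.

(* The row equations of the limit problem, solved along each chain: forwards from
   (j, 1) for j >= rho, backwards from (j, j) for j < rho. *)
Definition base_coords (j l : nat) : 'M[R[i]]_(s j, r) :=
  if (rho <= j)%N then
    if (l <= rho)%N then ctr (Sigma j 1%N) *m B *m Om ^+ l.-1
    else (if l == rho.+1 then ctr (Sigma j 1%N) *m B *m Om ^+ rho else 0)
         - ctr (Sigma j l.-1) *m (D *m B)
  else ctr (Sigma j j) *m (D *m B) *m invmx Om ^+ (j.+1 - l).

(** In the complementary row the right side carries a factor [e], so at [e = 0] that row determines
    the last argument. *)
Definition base_solution : 'M[R[i]]_(n, r) :=
  from_coords k Xi Xic base_coords
    (- (invmx (A22 - lambda0%:M) *m (ctr Sigmac *m (D *m B)))).

Lemma base_coordE j l : (0 < l <= j)%N -> (j <= k)%N ->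
  ctr (Sigma j l) *m base_solution = base_coords j l.
Proof. by move=> lj jk; rewrite (from_coordsK hA). Qed.

(** [wexp j l] vanishes exactly for [l = 1] and [j >= rho]. *)
Lemma vscale0_coord j l p (V : 'M[R[i]]_(n, p)) : (0 < l <= j)%N -> (j <= k)%N ->
  ctr (Sigma j l) *m (vscale 0 *m V) =
    if (l == 1%N) && (rho <= j)%N then ctr (Sigma j l) *m V else 0.
Proof.
move=> lj jk; rewrite (scaling0_coord hA)//; congr (if _ then _ else _).
by rewrite /wexp; have [] := leqP rho j; lia.
Qed.

Lemma vscale0_compl p (V : 'M[R[i]]_(n, p)) : ctr Sigmac *m (vscale 0 *m V) = 0.
Proof. by rewrite (scaling0_compl hA) ifN// -lt0n. Qed.

Lemma first_coord_lead : ctr (Sigma rho 1%N) *m B = Q.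
Proof.
by rewrite mulmxA (leading_cols_coord1 D hA)// mul1mx.
Qed.

Lemma vscale0_base : vscale 0 *m base_solution = B.
Proof.
apply: (coords_inj hA) => [j l lj jk|]; last first.
  by rewrite vscale0_compl mulmxA (leading_cols_compl D hA)// mul0mx.
rewrite vscale0_coord//; case: ifPn => [/andP[/eqP el rj]|h].
  by rewrite base_coordE// /base_coords rj el hrho1 expr0 -[1]/(1%:M) mulmx1.
by rewrite mulmxA (leading_cols_coord0 D hA)// ?mul0mx//; move: h; lia.
Qed.

(** The weight rises by one from [l] to [l.+1] as long as [l <= rho]; beyond that it is capped and a
    factor [e] remains. *)
Lemma pencilK0_coord j l p (V : 'M[R[i]]_(n, p)) : (0 < l <= j)%N -> (j <= k)%N ->
  ctr (Sigma j l) *m (pencilK 0 *m V) =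
    if (l <= rho)%N then ctr (Sigma j l) *m V else 0.
Proof.
move=> lj jk; rewrite (scaling0_coord hA)//; congr (if _ then _ else _).
by rewrite /wexp; have [] := leqP rho j; lia.
Qed.

(** [D] survives in the rows where [wexp j l.+1] has reached [rho]: those with [l >= rho] in long
    chains, the last one in short chains. *)
Lemma pencilM0_coord j l p (V : 'M[R[i]]_(n, p)) : (0 < l <= j)%N -> (j <= k)%N ->
  ctr (Sigma j l) *m (pencilM 0 *m V) =
    (if (l < j)%N then ctr (Sigma j l.+1) *m V else 0) +
    (if if (rho <= j)%N then (rho <= l)%N else l == j
     then ctr (Sigma j l) *m (D *m (vscale 0 *m V)) else 0).
Proof.
move=> lj jk; rewrite pencilM_coord//; congr (_ + _); rewrite expr0n.
set b := (_ == 0%N); set b' := (if (rho <= j)%N then _ else _); have -> : b = b'.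
  by rewrite /b /b' /wexp; have [] := leqP rho j; lia.
by case: b'; rewrite ?scale1r ?scale0r.
Qed.

Lemma base_equation :
  pencilM 0 *m base_solution = pencilK 0 *m base_solution *m Om.
Proof.
have Ou := Om_unit.
apply: (coords_inj hA) => [j l lj jk|]; last first.
  rewrite pencilM_compl -mulmxA (scaling0_compl hA) vscale0_base.
  by rewrite (from_coords_compl hA) mulmxN mulKVmx ?A22_unit// addNr.
have eY : ctr (Sigma j l) *m (base_solution *m Om) = base_coords j l *m Om.
  by rewrite mulmxA base_coordE.
rewrite pencilM0_coord// -(mulmxA (pencilK 0)) pencilK0_coord// vscale0_base eY.
(* In chains shorter than [rho], [Om] cancels one factor [invmx Om]; the last row starts the
   recursion from [D *m B]. *)
have [rj|jr] := leqP rho j; last first.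
  have -> : (l <= rho)%N by lia.
  have rjF : (rho <= j)%N = false by lia.
  have lj1 : (l <= j)%N by lia.
  rewrite /base_coords rjF (subSn lj1).
  rewrite exprSr -[_ * _]/(_ *m _) -[RHS]mulmxA -[_ *m invmx Om *m Om]mulmxA mulVmx// mulmx1.
  have [lj'|] := ltnP l j.
    rewrite base_coordE; [|lia|by []].
    rewrite /base_coords rjF ifN; last lia.
    by rewrite addr0 subSS.
  move=> jl; have -> : l = j by lia.
  by rewrite eqxx add0r subnn expr0 -[1]/(1%:M) mulmx1.
have [lr|lr] := ltnP l rho.
  rewrite ifT; last lia. rewrite base_coordE; [|lia|by []].
  rewrite (ltnW lr) /base_coords rj lr (ltnW lr) addr0 -[RHS]mulmxA.
  by rewrite -[Om ^+ l.-1 *m Om]/(Om ^+ l.-1 * Om) -exprSr prednK; [|lia].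
have [el|nl] := eqVneq l rho.
  subst l; rewrite leqnn /base_coords rj leqnn -[RHS]mulmxA.
  rewrite -[Om ^+ _ *m Om]/(_ * _) -exprSr prednK//.
  have [jr'|] := ltnP rho j.
    rewrite base_coordE; [|lia|by []].
    by rewrite /base_coords rj ltnn eqxx/= subrK.
  (* The last row of the chains of length [rho] is the relation [S *m Q = Q *m Om ^+ rho]. *)
  move=> jr'; have ej : j = rho by lia.
  subst j; rewrite add0r first_coord_lead; have [_ <-] := krylov_blocks.
  by rewrite [D *m B]mulmxA [LHS]mulmxA (leading_cols_S).
(* Past [rho] the right side is zero, and at the end of a chain the choice of [G_rho^(rho)] makes
   the term in [D] vanish. *)
have {nl}lr' : (rho < l)%N by lia.
rewrite [(l <= rho)%N]leqNgt lr'/=.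
have [lj'|jl] := ltnP l j; last first.
  have ej : l = j by lia.
  by subst l; rewrite add0r [D *m B]mulmxA [LHS]mulmxA (leading_cols_W hW)// ?mul0mx//; lia.
rewrite base_coordE; [|lia|by []].
rewrite /base_coords rj ifN; last lia.
rewrite ifN; last lia.
by rewrite sub0r addNr.
Qed.

(** * Injectivity of the linearised limit problem *)

Variable P : 'M[R[i]]_(r, \sum_(a < rho) s rho).
Hypothesis hP : forall Psi Delta : 'M[R[i]]_(_, r),
  Thetamx k D Xi Sigma rho *m Psi = Psi *m Om + Phi *m Delta -> P *m Psi = 0 -> Psi = 0.

(** The last rows of the chains longer than [rho] force [X] to be [lead] times its coordinate
    [(rho, 1)]. The rows of the chains of length [rho] then form the equation in [hP], so these
    coordinates vanish. Hence [X = 0], [Dl = 0] because [Phi] is injective, and the other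
    coordinates vanish along each chain. *)
Lemma pencil_injective (Z : 'M[R[i]]_(n, r)) (Dl : 'M[R[i]]_r) :
  pencilM 0 *m Z = pencilK 0 *m Z *m Om + pencilK 0 *m base_solution *m Dl ->
  P *m \mxcol_(a < rho) ctr (Sigma rho a.+1) *m Z = 0 -> Z = 0 /\ Dl = 0.
Proof.
move=> hZ; rewrite -mulmxA mxcol_mul => hPZ; set X := vscale 0 *m Z.
have row j l : (0 < l <= j)%N -> (j <= k)%N ->
    (if (l < j)%N then ctr (Sigma j l.+1) *m Z else 0) +
    (if if (rho <= j)%N then (rho <= l)%N else l == j
     then ctr (Sigma j l) *m (D *m X) else 0) =
    if (l <= rho)%N then ctr (Sigma j l) *m Z *m Om + base_coords j l *m Dl else 0.
  move=> lj jk; rewrite -pencilM0_coord// hZ mulmxDr [X in X + _]mulmxA [X in _ + X]mulmxA.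
  rewrite !pencilK0_coord// base_coordE//.
  by case: ifP => // _; rewrite !mul0mx addr0.
have eX : X = lead *m (ctr (Sigma rho 1%N) *m X).
  apply: (leading_cols_unique hA hW) => // [j l lj jk h||j /andP[rj jk]].
  - by rewrite vscale0_coord// ifN//; move: h; lia.
  - exact: vscale0_compl.
  - have jj : (0 < j <= j)%N by lia.
    by have := row j j jj jk; rewrite ltnn (ltnW rj) leqNgt rj add0r.
have X1 : ctr (Sigma rho 1%N) *m X = ctr (Sigma rho 1%N) *m Z.
  by rewrite vscale0_coord// leqnn.
have [ePhi SQ] := krylov_blocks.
have Psi0 : \mxcol_(a < rho) (ctr (Sigma rho a.+1) *m Z) = 0.
  apply: (hP (Delta := Dl)) => //.
  rewrite (theta_mxcol (fun a => ctr (Sigma rho a.+1) *m Z)) [in RHS]ePhi !mxcol_mul -mxcolD.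
  apply: eq_mxcol => a; have ar := ltn_ord a.
  have /= := row rho a.+1 ar hrhok.
  rewrite leqnn ar {1}/base_coords leqnn ar first_coord_lead /= => <-.
  case: ifPn => ar'; first by rewrite ifN ?addr0// -ltnNge.
  have ea : a.+1 = rho by lia.
  rewrite [in RHS]ifT ?ea// add0r eX X1 [D *m _]mulmxA [RHS]mulmxA.
  by rewrite leading_cols_S.
have Zr l : (0 < l <= rho)%N -> ctr (Sigma rho l) *m Z = 0.
  case: l => // l lr; move: Psi0; rewrite -mxcol0 => /eq_mxcolP.
  by move=> /(_ (Ordinal lr)).
have X0 : X = 0 by rewrite eX X1 Zr ?mulmx0// hrho1/=.
have Dl0 : Dl = 0.
  apply: Phi_inj; rewrite ePhi mxcol_mul -mxcol0; apply: eq_mxcol => a.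
  have ar := ltn_ord a.
  have /= := row rho a.+1 ar hrhok.
  rewrite leqnn ar X0 !mulmx0 if_same addr0 /base_coords leqnn ar first_coord_lead /=.
  rewrite (Zr a.+1)// mul0mx add0r => <-; case: ifP => // ar'; exact: Zr.
split=> //; apply: (coords_inj hA) => [j l|]; rewrite mulmx0; last first.
  have hc : pencilM 0 *m Z = pencilK 0 *m (Z *m Om).
    by rewrite hZ Dl0 mulmx0 addr0 mulmxA.
  have := pencilM_compl 0 Z.
  rewrite hc (scaling0_compl hA)/= -/X X0 !mulmx0 addr0 => /esym h.
  by rewrite -[LHS](mulKmx A22_unit) h mulmx0.
have {}row i l' : (0 < l' <= i)%N -> (i <= k)%N ->
    (if (l' < i)%N then ctr (Sigma i l'.+1) *m Z else 0) =
    if (l' <= rho)%N then ctr (Sigma i l') *m Z *m Om else 0.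
  by move=> li ik; have := row i l' li ik; rewrite X0 Dl0 !mulmx0 if_same !addr0.
(* Long chains start at [(j, 1)], where [X = 0] gives zero; short chains are followed backwards from
   [(j, j)] by cancelling [Om]. *)
have [rj|jr] := leqP rho j.
  elim: l => // -[_ _ jk|l IH lj jk].
    have j0 : (0 < 1 <= j)%N by lia.
    by have := vscale0_coord Z j0 jk; rewrite rj/= -/X X0 mulmx0.
  have := row j l.+1; rewrite ifT; last lia.
  move=> ->; [|lia|by []]; case: ifP => // _.
  by rewrite IH ?mul0mx//; lia.
move=> lj jk; have [m em] : exists m, (l + m = j)%N by exists (j - l)%N; lia.
have Ou := Om_unit.
elim: m l lj em => [|m IH] l lj em; have := row j l lj jk.
  by rewrite addn0 in em; subst l; rewrite ltnn (ltnW jr) => h;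
    rewrite -[LHS](mulmxK Ou) -h mul0mx.
rewrite ifT; last lia.
rewrite [RHS]ifT; last lia.
by rewrite IH; [|lia|lia] => h; rewrite -[LHS](mulmxK Ou) -h mul0mx.
Qed.

Lemma perturbed_solution :
  exists b e0, [/\ 0 <= b, 0 < e0 & forall e, 0 <= e <= e0 -> exists Z Dl,
    [/\ pencilM e *m (base_solution + Z) = pencilK e *m (base_solution + Z) *m (Om + Dl),
        nrm Z <= b * e & nrm Dl <= b * e]].
Proof.
have [aK aK0 hK] : lipschitz_at0 pencilK by exact: scaling_lipschitz.
have [aM aM0 hM] : lipschitz_at0 pencilM.
  apply: lipschitz_at0D; first exact: lipschitz_at0_cst.
  apply: lipschitz_at0M; last exact: scaling_lipschitz.
  by apply: lipschitz_at0M; [exact: scaling_lipschitz|exact: lipschitz_at0_cst].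
apply: (deflating_subspace_perturbation (a := aM + aK) _ base_equation
  (P := P *m \mxcol_(a < rho) ctr (Sigma rho a.+1))).
  move=> e he; have /andP[e0 _] := he; split.
    by apply: le_trans (hM _ he) _; rewrite ler_wpM2r// lerDl.
  by apply: le_trans (hK _ he) _; rewrite ler_wpM2r// lerDr.
exact: pencil_injective.
Qed.

End ScaledProblem.

Lemma coprimep_remaining (R : realType) r (Om : 'M[R[i]]_r) (rest : seq R[i]) :
  (forall z, eigenvalue Om z -> z \notin rest) ->
  coprimep (char_poly Om) (\prod_(z <- rest) ('X - z%:P)).
Proof.
move=> h; apply/Pdiv.ClosedField.coprimepP => x; rewrite -eigenvalue_root_char.
by move=> /h; rewrite -root_prod_XsubC.
Qed.

Lemma powR_root (R : realType) (t : R) (m q : nat) :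
  t `^ (m%:R / q%:R) = (t `^ (1 / q%:R)) ^+ m.
Proof. by rewrite -powR_mulrn ?powR_ge0// -powRrM mul1r mulrC. Qed.

Lemma exprmxZ (F : comPzRingType) r (a : F) (M : 'M[F]_r) l :
  (a *: M) ^+ l = a ^+ l *: M ^+ l.
Proof.
elim: l => [|l IH]; first by rewrite !expr0 scale1r.
rewrite !exprS IH -[LHS]/(_ *m _) -[M * _]/(_ *m _).
by rewrite -scalemxAl -scalemxAr scalerA.
Qed.

(** * The theorem *)

Theorem theorem3 (R : realType) (n k c : nat) (s : nat -> nat)
    (hn : (jordan_dim k s + c)%N = n)
    (A D : 'M[R[i]]_n) (lambda0 : R[i])
    (Xi Sigma : forall j : nat, nat -> 'M[R[i]]_(n, s j))
    (Xic Sigmac : 'M[R[i]]_(n, c)) (A22 : 'M[R[i]]_c)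
    (hA : jordan_structure hn A lambda0 Xi Sigma Xic Sigmac A22)
    (hW : forall i : nat, (1 <= i <= k)%N -> Wmx k D Xi Sigma i \in unitmx)
    (rho : nat) (hrho1 : (0 < rho)%N) (hrhok : (rho <= k)%N)
    (r : nat) (Omega : 'M[R[i]]_r) (Phi : 'M[R[i]]_(\sum_(a < rho) s rho, r))
    (hrank : \rank Phi = r)
    (hPhi : Thetamx k D Xi Sigma rho *m Phi = Phi *m Omega)
    (rest : seq R[i])
    (hrest : remaining_eigenvalues (Thetamx k D Xi Sigma rho) Omega rest)
    (hdisj : forall z : R[i], eigenvalue Omega z -> z \notin rest)
    (Q1 : 'M[R[i]]_(s rho, r))
    (hQ1 : Q1 = submxcol Phi (Ordinal hrho1)) :
  Phi = \mxcol_(a < rho) (Q1 *m Omega ^+ a) /\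
  exists (H : R -> 'M[R[i]]_(n, r)) (C : R -> 'M[R[i]]_r)
         (Hb : forall j : nat, R -> 'M[R[i]]_(\sum_(l < j) s j, r)),
    [/\ \forall t \near 0^'+, (A + t%:C *: D) *m H t = H t *m C t,
        isO_pow
          (fun t => C t - (lambda0%:M + (t `^ (1 / rho%:R))%:C *: Omega))
          (2 / rho%:R),
        isO_pow
          (fun t => H t - (leading_cols k D Xi Sigma rho *m Q1
                     + \sum_(1 <= j < k.+1) jordan_cols_at Xi j *m Hb j t))
          1,
        isO_pow_blocks
          (fun t => Hb rho t
             - \mxcol_(l < rho)
                 (if l == 0%N :> nat then 0
                  else Q1 *m ((t `^ (1 / rho%:R))%:C *: Omega) ^+ l
                  : 'M[R[i]]_(s rho, r)))
          (fun l => l%:R / rho%:R)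
      & (forall j : nat, (1 <= j <= rho.-1)%N ->
           isO_pow_blocks (Hb j)
             (fun l => 1 - (j.+1 - l)%N%:R / rho%:R)) /\
        (forall j : nat, (rho.+1 <= j <= k)%N ->
           isO_pow_blocks (Hb j)
             (fun l => if l == 1%N then 1 / rho%:R
                       else (minn l.-1 rho)%:R / rho%:R))].
Proof.
have [ePhi SQ] := krylov_blocks hPhi hQ1.
split=> //.
have [P hP] := deflating_complement hrank hPhi hrest (coprimep_remaining hdisj).
have [b [e0 [b0 e00 hsol]]] := perturbed_solution hA hW hrhok hrank hPhi hQ1 hP.
set V0 := base_solution _ _ _ _ _ _ _ _ _ _ in hsol.
pose B := leading_cols k D Xi Sigma rho *m Q1.
pose ee (t : R) := t `^ (1 / rho%:R).
(* [t <= e1 ^+ rho] ensures both [ee t <= 1] and [ee t <= e0]. *)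
pose e1 := Order.min 1 e0.
have e10 : 0 < e1 by rewrite lt_min ltr01.
pose t0 := e1 ^+ rho.
have t00 : 0 < t0 by exact: exprn_gt0.
have rho0 : rho%:R != 0 :> R by rewrite pnatr_eq0 -lt0n.
have eerho t : 0 < t -> ee t ^+ rho = t.
  by move=> t_gt0; rewrite -powR_root divff// powRr1// ltW.
have ee0 t : 0 <= ee t by exact: powR_ge0.
have ee1 t : 0 < t <= t0 -> ee t <= e1.
  move=> /andP[t_gt0 tt0]; rewrite leNgt; apply/negP => h.
  have : e1 ^+ rho < ee t ^+ rho by rewrite ltr_pXn2r ?nnegrE// ltW.
  by rewrite eerho// ltNge tt0.
(* The guarded statement, with the default [(0, 0)] outside the interval, allows solutions to be
   chosen as functions of all real [t]. *)
have hex t : exists ZD : 'M[R[i]]_(n, r) * 'M[R[i]]_r, 0 < t <= t0 ->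
    [/\ pencilM k A D lambda0 Xi Sigma Xic Sigmac rho (ee t) *m (V0 + ZD.1) =
        pencilK k Xi Sigma Xic Sigmac rho (ee t) *m (V0 + ZD.1) *m (Omega + ZD.2),
        nrm ZD.1 <= b * ee t & nrm ZD.2 <= b * ee t].
  have [ht|ht] := boolP (0 < t <= t0); last by exists (0, 0).
  have [|Z [Dl h]] := hsol (ee t); last by exists (Z, Dl).
  by rewrite ee0 (le_trans (ee1 _ ht))// ge_min lexx orbT.
have [ZD hZD] := boolp.choice hex.
pose Z t := (ZD t).1; pose Dl t := (ZD t).2.
have hZ t : 0 < t <= t0 -> nrm (Z t) <= b * ee t by move=> /hZD[].
have hDl t : 0 < t <= t0 -> nrm (Dl t) <= b * ee t by move=> /hZD[].
pose H t := vscale k Xi Sigma Xic Sigmac rho (ee t) *m (V0 + Z t).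
have hV t : 0 < t <= t0 -> nrm (V0 + Z t) <= nrm V0 + b.
  move=> ht; apply: le_trans (nrmD _ _) _; rewrite lerD2l.
  apply: le_trans (hZ _ ht) _; rewrite -[leRHS]mulr1 ler_wpM2l//.
  by rewrite (le_trans (ee1 _ ht))// ge_min lexx.
have H_coord t j l : (0 < l <= j)%N -> (j <= k)%N ->
    ctr (Sigma j l) *m H t = (ee t ^+ wexp rho j l)%:C *: (ctr (Sigma j l) *m (V0 + Z t)).
  by move=> lj jk; rewrite (scaling_coord hA).
have B_coord0 j l : (0 < l <= j)%N -> (j <= k)%N -> (l != 1%N) || (j < rho)%N ->
    ctr (Sigma j l) *m B = 0.
  by move=> lj jk h; rewrite mulmxA (leading_cols_coord0 D hA)// mul0mx.
have B_compl : ctr Sigmac *m B = 0.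
  by rewrite mulmxA (leading_cols_compl D hA)// mul0mx.
have B_first j : (rho <= j <= k)%N -> ctr (Sigma j 1%N) *m B = ctr (Sigma j 1%N) *m V0.
  move=> /andP[rj jk]; have j0 : (0 < 1 <= j)%N by lia.
  have := vscale0_coord hA hrho1 hrhok hrank V0 j0 jk.
  by rewrite rj (vscale0_base D hA hrho1 hrhok Omega hrank)/=.
(* Taking all Jordan coordinates of [H t - B] leaves only the complementary component as remainder,
   and its weight is [ee t ^+ rho = t]. *)
pose Hb j t : 'M[R[i]]_(\sum_(l < j) s j, r) :=
  \mxcol_(l < j) (ctr (Sigma j l.+1) *m (H t - B)).
exists H, (fun t => lambda0%:M + (ee t)%:C *: (Omega + Dl t)), Hb.
split.
- near=> t.
  have t_gt0 : 0 < t by near: t; exact: nbhs_right_gt.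
  have ht : 0 < t <= t0 by rewrite t_gt0; near: t; exact: nbhs_right_le.
  have [h _ _] := hZD _ ht.
  by have := unscale hA hrho1 hrhok h; rewrite eerho.
(* The error in [C] is [ee t] times [Dl t], hence of second order in [ee t]. *)
- apply: (@isO_pow_nrm _ _ _ _ _ b _ t00) => t ht.
  rewrite opprD addrACA subrr add0r scalerDr addrAC subrr add0r nrmZ//.
  rewrite powR_root -/(ee t) expr2 mulrA [leLHS]mulrC.
  by apply: ler_wpM2r => //; exact: hDl.
- apply: (@isO_pow_nrm _ _ _ _ _ (nrm Xic * (nrm (ctr Sigmac) * (nrm V0 + b))) _ t00).
  move=> t ht; have /andP[t_gt0 _] := ht.
  have -> : H t - (leading_cols k D Xi Sigma rho *m Q1 +
      \sum_(1 <= j < k.+1) jordan_cols_at Xi j *m Hb j t) =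
      (ee t ^+ rho)%:C *: (Xic *m (ctr Sigmac *m (V0 + Z t))).
    rewrite opprD addrA -/B.
    rewrite -[X in X - _]mul1mx -(resolution_of_identity hA) mulmxDl addrAC.
    rewrite big_add1 big_mkord mulmx_suml -sumrB big1 ?add0r => [|j _]; last first.
      rewrite /jordan_cols_at /Hb mul_mxrow_mxcol mulmx_suml -sumrB big1// => l _.
      by rewrite mulmxA subrr.
    by rewrite -mulmxA mulmxBr (scaling_compl hA) B_compl subr0 -scalemxAr.
  rewrite nrmZ ?exprn_ge0// eerho// powRr1 ?(ltW t_gt0)// mulrC ler_wpM2r ?(ltW t_gt0)//.
  apply: le_trans (nrmM _ _) _; apply: ler_wpM2l; first exact: nrm_ge0.
  apply: le_trans (nrmM _ _) _; apply: ler_wpM2l; first exact: nrm_ge0.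
  exact: hV.
- move=> l; apply: (@isO_pow_nrm _ _ _ _ _ (nrm (ctr (Sigma rho l.+1)) * b) _ t00) => t ht.
  have lr := ltn_ord l.
  rewrite submxcolB !mxcolK mulmxBr H_coord// /wexp leqnn/= (minn_idPl (ltnW lr)).
  (* In the chains of length [rho], [V0] has coordinates [Q1 *m Omega ^+ l]. For [l = 0] this is
     cancelled by [B], for [l > 0] by the predicted term, and only [Z t] remains. *)
  have -> : (ee t ^+ l)%:C *: (ctr (Sigma rho l.+1) *m (V0 + Z t)) -
      ctr (Sigma rho l.+1) *m B -
      (if l == 0%N :> nat then 0 else Q1 *m ((t `^ (1 / rho%:R))%:C *: Omega) ^+ l) =
      (ee t ^+ l)%:C *: (ctr (Sigma rho l.+1) *m Z t).
    rewrite mulmxDr; case: ifP => [/eqP l0|l0].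
      by rewrite l0 expr0 !scale1r subr0 B_first ?leqnn// addrAC subrr add0r.
    have -> : ctr (Sigma rho l.+1) *m B = 0 by apply: B_coord0 => //; lia.
    rewrite subr0 (base_coordE D hA)// /base_coords leqnn lr /=.
    rewrite (first_coord_lead D hA)// -/(ee t).
    have -> : ((ee t)%:C *: Omega) ^+ l = (ee t ^+ l)%:C *: Omega ^+ l.
      by rewrite exprmxZ rmorphXn.
    by rewrite -scalemxAr scalerDr addrAC subrr add0r.
  rewrite nrmZ ?exprn_ge0// powR_root -/(ee t) exprS mulrA [leRHS]mulrC.
  apply: ler_wpM2l; first by rewrite exprn_ge0.
  rewrite -mulrA; apply: le_trans (nrmM _ _) _.
  by apply: ler_wpM2l; [exact: nrm_ge0|exact: hZ].
- split=> j hj l; have lj := ltn_ord l.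
    apply: (@isO_pow_nrm _ _ _ _ _ (nrm (ctr (Sigma j l.+1)) * (nrm V0 + b)) _ t00).
    move=> t ht; rewrite mxcolK mulmxBr B_coord0 ?subr0; [|lia|lia|lia].
    rewrite H_coord; [|lia|lia].
    (* For chains shorter than [rho] the predicted exponent is [wexp] divided by [rho], so
       boundedness of [V0 + Z t] suffices. *)
    have -> : 1 - (j.+1 - l.+1)%:R / rho%:R = (wexp rho j l.+1)%:R / rho%:R :> R.
      rewrite /wexp ifF; last lia.
      have ar : (j.+1 - l.+1 <= rho)%N by lia.
      by rewrite (natrB _ ar) mulrBl divff.
    rewrite nrmZ ?exprn_ge0// powR_root -/(ee t) mulrC.
    apply: ler_wpM2r; first by rewrite exprn_ge0.
    apply: le_trans (nrmM _ _) _; apply: ler_wpM2l; first exact: nrm_ge0.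
    exact: hV.
  have jk : (j <= k)%N by lia.
  have rj : (rho <= j)%N by lia.
  (* The first block row has weight zero; its smallness comes from [B] cancelling the coordinate of
     [V0]. *)
  have [l0|l0] := eqVneq (l : nat) 0%N.
    rewrite l0 eqxx.
    apply: (@isO_pow_nrm _ _ _ _ _ (nrm (ctr (Sigma j 1%N)) * b) _ t00) => t ht.
    rewrite mxcolK l0 mulmxBr H_coord; [|lia|lia].
    rewrite B_first ?rj// /wexp rj/= min0n expr0 scale1r mulmxDr addrAC subrr add0r.
    by rewrite -mulrA; apply: le_trans (nrmM _ _) _;
      apply: ler_wpM2l; [exact: nrm_ge0|exact: hZ].
  rewrite eqSS (negPf l0).
  apply: (@isO_pow_nrm _ _ _ _ _ (nrm (ctr (Sigma j l.+1)) * (nrm V0 + b)) _ t00).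
  move=> t ht; rewrite mxcolK mulmxBr B_coord0 ?subr0; [|lia|lia|lia].
  rewrite H_coord; [|lia|lia].
  rewrite /wexp rj nrmZ ?exprn_ge0// powR_root -/(ee t) mulrC.
  apply: ler_wpM2r; first by rewrite exprn_ge0.
  apply: le_trans (nrmM _ _) _; apply: ler_wpM2l; first exact: nrm_ge0.
  exact: hV.
Unshelve. all: by end_near.
Qed.
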